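(* Let $n\in\mathbb{N}$ and $\alpha=n/2$. Then for all $f\in L^2(\mathbb{R}^n)$, $$\|e^{-t(-\Delta)^{\alpha}}f\|_{L^2_t((0,\infty);BMO_x(\mathbb{R}^n))}\lesssim \|f\|_{L^2(\mathbb{R}^n)}.$$
   Context: For $t\ge 0$, $e^{-t(-\Delta)^{\alpha}}f=\mathcal{F}^{-1}\big(e^{-t|\xi|^{2\alpha}}\mathcal{F}f(\xi)\big)$, where $\mathcal{F}$ is the Fourier transform on $\mathbb{R}^n$. $BMO(\mathbb{R}^n)$ is the space of locally integrable $f$ with $\|f\|_{BMO}=\big(\sup_Q \mathcal{L}(Q)^{-n}\int_Q|f(x)-f_Q|^2dx\big)^{1/2}<\infty$, the supremum over cubes $Q$ with sides parallel to the axes, $\mathcal{L}(Q)$ the sidelength, $f_Q$ the average of $f$ on $Q$. $A\lesssim B$ means $A\le CB$ for a positive constant $C$ independent of $f$. *)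

(* Defs.v *)
From HB Require Import structures.
From mathcomp Require Import all_boot all_order all_algebra.
From mathcomp Require Import all_classical all_reals all_analysis.
Set Implicit Arguments. Unset Strict Implicit. Unset Printing Implicit Defensive.
Import Order.TTheory GRing.Theory Num.Theory.
Import numFieldNormedType.Exports.
Local Open Scope classical_set_scope.
Local Open Scope ring_scope.

(* Points of R^n are n-tuples of reals; R^n carries the product sigma-algebra
   (library instance on n.-tuple). *)

(* Lebesgue integral over R^n, as the iterated Lebesgue integral
   \int dx_1 \int dx_2 ... \int dx_n f(x_1,...,x_n)
   (equal to the integral w.r.t. n-dimensional Lebesgue measure for
   nonnegative measurable or integrable f, by Tonelli/Fubini). *)
Fixpoint Rn_integral (R : realType) (n : nat) :
    (n.-tuple R -> \bar R) -> \bar R :=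
  match n return (n.-tuple R -> \bar R) -> \bar R with
  | 0 => fun f => f [tuple]
  | m.+1 => fun f =>
      (\int[@lebesgue_measure R]_(x in setT)
          Rn_integral (fun t : m.-tuple R => f (cons_tuple x t)))%E
  end.

Definition dotRn (R : realType) n (x y : n.-tuple R) : R :=
  \sum_(i < n) tnth x i * tnth y i.
Definition euclid (R : realType) n (x : n.-tuple R) : R :=
  Num.sqrt (\sum_(i < n) tnth x i ^+ 2).

(* A complex-valued function on R^n is represented by its real and
   imaginary parts (g1, g2).  f = f1 + i f2 is in L^2(R^n): *)
Definition L2fun (R : realType) n (f1 f2 : n.-tuple R -> R) : Prop :=
  measurable_fun setT f1 /\ measurable_fun setT f2 /\
  (Rn_integral (fun x => (f1 x ^+ 2 + f2 x ^+ 2)%:E) < +oo)%E.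

Definition L2norm_sq (R : realType) n (f1 f2 : n.-tuple R -> R) : \bar R :=
  Rn_integral (fun x => (f1 x ^+ 2 + f2 x ^+ 2)%:E).

(* Fourier transform of the truncation f 1_{|x| <= r}:
   \int_{|x|<=r} f(x) e^{-2 pi i x.xi} dx, real part and imaginary part.
   (f1 + i f2)(cos - i sin) = (f1 cos + f2 sin) + i (f2 cos - f1 sin). *)
Definition trunc_FT_re (R : realType) n (f1 f2 : n.-tuple R -> R) (r : R)
    (xi : n.-tuple R) : R :=
  fine (Rn_integral (fun x =>
    (if euclid x <= r then
       f1 x * cos (2 * pi * dotRn x xi) + f2 x * sin (2 * pi * dotRn x xi)
     else 0)%:E)).
Definition trunc_FT_im (R : realType) n (f1 f2 : n.-tuple R -> R) (r : R)
    (xi : n.-tuple R) : R :=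
  fine (Rn_integral (fun x =>
    (if euclid x <= r then
       f2 x * cos (2 * pi * dotRn x xi) - f1 x * sin (2 * pi * dotRn x xi)
     else 0)%:E)).

Definition is_L2_FT (R : realType) n (f1 f2 G1 G2 : n.-tuple R -> R) : Prop :=
  measurable_fun setT G1 /\ measurable_fun setT G2 /\
  (fun r : R => Rn_integral (fun xi =>
       ((trunc_FT_re f1 f2 r xi - G1 xi) ^+ 2
        + (trunc_FT_im f1 f2 r xi - G2 xi) ^+ 2)%:E))
    @ +oo%R --> 0%E.

Definition frac_heat_symbol (R : realType) n (alpha t : R) (xi : n.-tuple R) : R :=
  expR (- (t * powR (euclid xi) (2 * alpha))).

(* e^{-t(-Delta)^alpha} f (x) = F^{-1}( e^{-t|xi|^{2alpha}} G )(x), with G the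
   Fourier transform of f and F^{-1} h (x) = \int h(xi) e^{2 pi i x.xi} dxi;
   real part and imaginary part. *)
Definition frac_heat_re (R : realType) n (alpha : R) (G1 G2 : n.-tuple R -> R)
    (t : R) (x : n.-tuple R) : R :=
  fine (Rn_integral (fun xi =>
    (frac_heat_symbol alpha t xi *
      (G1 xi * cos (2 * pi * dotRn x xi) - G2 xi * sin (2 * pi * dotRn x xi)))%:E)).
Definition frac_heat_im (R : realType) n (alpha : R) (G1 G2 : n.-tuple R -> R)
    (t : R) (x : n.-tuple R) : R :=
  fine (Rn_integral (fun xi =>
    (frac_heat_symbol alpha t xi *
      (G1 xi * sin (2 * pi * dotRn x xi) + G2 xi * cos (2 * pi * dotRn x xi)))%:E)).

Definition cube (R : realType) n (a : n.-tuple R) (l : R) : set (n.-tuple R) :=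
  [set x | forall i : 'I_n, tnth a i <= tnth x i <= tnth a i + l].

Definition cube_integral (R : realType) n (a : n.-tuple R) (l : R)
    (g : n.-tuple R -> R) : \bar R :=
  Rn_integral (fun x => ((\1_(cube a l) x : R) * g x)%:E).

Definition cube_avg (R : realType) n (a : n.-tuple R) (l : R)
    (g : n.-tuple R -> R) : R :=
  fine (cube_integral a l g) / l ^+ n.

Definition BMO_norm_sq (R : realType) n (g1 g2 : n.-tuple R -> R) : \bar R :=
  ereal_sup [set (((l ^+ n)^-1)%:E *
                 cube_integral a l (fun x => ((g1 x - cube_avg a l g1) ^+ 2
                                             + (g2 x - cube_avg a l g2) ^+ 2)%R))%E
            | l in [set l : R | 0 < l] & a in [set: n.-tuple R]].

Definition L2t_BMO_norm_sq (R : realType) n (alpha : R)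
    (G1 G2 : n.-tuple R -> R) : \bar R :=
  (\int[@lebesgue_measure R]_(t in `]0%R, +oo[)
     BMO_norm_sq (frac_heat_re alpha G1 G2 t) (frac_heat_im alpha G1 G2 t))%E.

(* Main.v *)
(** Even the sup norm, not just the BMO norm, is square integrable in time.
    The solution is bounded by M(t), the integral of exp(- t |xi|^n) |G(xi)|.
    By Cauchy-Schwarz with the weight w = |xi|^(n/2), M(t)^2 is at most the
    integral of exp(- t |xi|^n) w |G|^2 times that of exp(- t |xi|^n) / w; the
    latter is O(t^(-1/2)) by homogeneity.  Integrating in t first (Tonelli) and
    using that the integral of t^(-1/2) exp(- t rho) over t > 0 is
    O(rho^(-1/2)) with rho = w^2 leaves a multiple of the squared L^2 norm of G.
    The bound of G by f is proved by Abel summation: inserting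
    exp(- e (|xi_1| + ... + |xi_n|)) turns the integral of the squared transform into a
    quadratic form in f with a product of Poisson kernels, which is handled by
    Schur's test uniformly in e. *)

Require Import Defs.
From HB Require Import structures.
From mathcomp Require Import all_boot all_order all_algebra.
From mathcomp Require Import all_classical all_reals all_analysis.
From mathcomp Require Import measurable_realfun.
From mathcomp Require Import ring lra.
Set Implicit Arguments. Unset Strict Implicit. Unset Printing Implicit Defensive.
Import Order.TTheory GRing.Theory Num.Theory.
Import numFieldNormedType.Exports.
Local Open Scope classical_set_scope.
Local Open Scope ring_scope.

(** Integrals over R^n are iterated, with no measure behind them, and [BMO_norm_sq] averages
    functions of x whose measurability is never established. Hence two layers: for nonnegative
    measurable or integrable functions the iterated integral is the integral against [Rn_measure],
    which brings Tonelli, Fubini and a.e. arguments; for all others only crude inequalities are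
    used, and absolute values then cost a factor 2 per coordinate. The choice alpha = n/2 makes the
    symbol exp(- t |xi|^n): volume scales as 1/t and w as t^(-1/2), whence the power t^(-1/2), and
    the time integral returns 1/w, which cancels w. Polar coordinates are avoided: |xi| dominates
    each |xi_i|, so the radial integrand is at most a product of functions of one coordinate. The
    Abel weight is convenient because its transform is a product of rational functions whose mass is
    read off from arctan; neither a Gaussian integral nor a density argument is needed. As G is only
    an L^2 limit of truncated transforms, the bound is proved for these, uniformly in the radius,
    and passed to the limit. *)

(** * Lebesgue measure on tuples *)

(* Unlike [ge0_le_integral], no measurability is required: [BMO_norm_sq] is a
   supremum over uncountably many cubes, so its measurability in time is unclear. *)
Lemma nonneg_le_integral d (T : measurableType d) (R : realType)
    (mu : {measure set T -> \bar R}) (D : set T) (f g : T -> \bar R) :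
  (forall x, D x -> 0 <= f x)%E -> (forall x, D x -> f x <= g x)%E ->
  (\int[mu]_(x in D) f x <= \int[mu]_(x in D) g x)%E.
Proof.
move=> f0 fg; rewrite !ge0_integralE//; last first.
  by move=> x Dx; rewrite (le_trans (f0 x Dx)) ?fg.
apply: ge_ereal_sup => _ [h hf <-]; apply: ereal_sup_ubound; exists h => //.
move=> x; apply: (le_trans (hf x)); rewrite !patchE.
by case: ifPn => // /set_mem Dx; exact: fg.
Qed.

(* The library's instance of this fact is shadowed by the one for products of
   subprobabilities, so that [sigma_finiteT] does not find it. *)
Lemma measurable_integral_param d1 d2 (T1 : measurableType d1) (T2 : measurableType d2)
    (R : realType) (mu : {sigma_finite_measure set T2 -> \bar R}) (g : T1 * T2 -> \bar R) :
  measurable_fun setT g -> measurable_fun setT (fun x => \int[mu]_y g (x, y))%E.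
Proof.
move=> mg.
have -> : (fun x => \int[mu]_y g (x, y))%E =
    (fubini_F mu (g^\+) \- fubini_F mu (g^\-))%E.
  apply/funext => y; rewrite /fubini_F [LHS]integralE.
  under eq_integral do rewrite funepos_comp/=.
  by under [X in (_ - X)%E = _]eq_integral do rewrite funeneg_comp/=.
apply: emeasurable_funB; apply: measurable_fun_fubini_tonelli_F => //.
  exact: measurable_funepos.
exact: measurable_funeneg.
Qed.

Lemma sigma_finite_product d1 d2 (T1 : measurableType d1) (T2 : measurableType d2)
    (R : realType) (m1 : {sigma_finite_measure set T1 -> \bar R})
    (m2 : {sigma_finite_measure set T2 -> \bar R}) :
  sigma_finite setT (m1 \x m2)%E.
Proof.
have /sigma_finiteP[F [TF ndF Foo]] := sigma_finiteT m1.
have /sigma_finiteP[G [TG ndG Goo]] := sigma_finiteT m2.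
exists (fun n => F n `*` G n) => [|k].
  rewrite -setXTT TF TG predeqE => -[x y]; split => [[[n _ Fnx] [k _ Gky]]|[n _ []]].
    exists (maxn n k) => //; split.
      by move: x {Gky} Fnx; exact/subsetPset/ndF/leq_maxl.
    by move: y {Fnx} Gky; exact/subsetPset/ndG/leq_maxr.
  by move=> ? ?; split; exists n.
have [? ?] := Foo k; have [? ?] := Goo k; split; first exact: measurableX.
by rewrite product_measure1E// lte_mul_pinfty// ge0_fin_numE.
Qed.

Section Rn_measure.
Context (R : realType).
Notation leb := (@lebesgue_measure R).

Definition cons_pair n (z : measurableTypeR R * n.-tuple R) : n.+1.-tuple R := cons_tuple z.1 z.2.

Lemma measurable_cons_pair n : measurable_fun setT (@cons_pair n).
Proof. exact: measurable_cons measurable_fst measurable_snd. Qed.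


Section step.
Context n (mu : {sigma_finite_measure set (n.-tuple R) -> \bar R}).

Definition cons_measure : {measure set (n.+1.-tuple R) -> \bar R}.
Proof.
unshelve refine (pushforward (leb \x mu)%E (@cons_pair n) :
  {measure set (n.+1.-tuple R) -> \bar R}).
exact: measurable_cons_pair.
Defined.

(** [inv] is a measurable left inverse of [cons_pair], so pulling an exhausting sequence back along
    [inv] preserves its measures. *)
Lemma sigma_finite_cons_measure : sigma_finite setT cons_measure.
Proof.
have [F FT Ffin] := sigma_finite_product leb mu.
pose inv (y : n.+1.-tuple R) := (thead y, [tuple of behead y]).
have invK z : inv (cons_pair z) = z.
  by case: z => x t; congr pair; exact: val_inj.
have minv : measurable_fun setT inv.
  apply: measurable_fun_pair; first exact: measurable_tnth.
  exact: measurable_behead.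
exists (fun i => inv @^-1` F i) => [|i].
  by rewrite -preimage_bigcup -FT preimage_setT.
have [mF muF] := Ffin i; split; first by rewrite -[X in measurable X]setTI; exact: minv.
rewrite /cons_measure /= /pushforward (_ : _ @^-1` _ = F i)//.
by apply/seteqP; split => z /=; rewrite invK.
Qed.

Definition cons_sfmeasure : {sigma_finite_measure set (n.+1.-tuple R) -> \bar R} :=
  HB.pack (cons_measure : set _ -> \bar R)
   (Measure.on cons_measure)
   (Measure_isSigmaFinite.Build _ _ _ (cons_measure : set _ -> _) sigma_finite_cons_measure).

Lemma integral_cons_sfmeasure (f : n.+1.-tuple R -> \bar R) :
  measurable_fun setT f -> (forall x, 0 <= f x)%E ->
  (\int[cons_sfmeasure]_x f x = \int[leb]_x \int[mu]_t f (cons_tuple x t))%E.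
Proof.
move=> mf f0.
have mc := @measurable_cons_pair n.
have -> : (\int[cons_sfmeasure]_x f x = \int[(leb \x mu)%E]_z (f \o @cons_pair n) z)%E.
  have := ge0_integral_pushforward mc (leb \x mu)%E measurableT mf (fun y _ => f0 y).
  by rewrite preimage_setT => <-.
rewrite fubini_tonelli1//; first exact: measurableT_comp mf mc.
by move=> z; exact: f0.
Qed.

End step.

(** Dimension 0 starts from the Dirac mass at the empty tuple, since the iterated integral over R^0
    is evaluation there. Sigma-finiteness is carried along because Tonelli needs it at the next
    step. *)
Lemma Rn_measure_ex n : exists mu : {sigma_finite_measure set (n.-tuple R) -> \bar R},
  forall f : n.-tuple R -> \bar R, measurable_fun setT f -> (forall x, 0 <= f x)%E ->
    Rn_integral f = (\int[mu]_x f x)%E.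
Proof.
elim: n => [|n [mu muE]].
  exists (@dirac _ (0.-tuple R) [tuple] R) => f mf f0 /=.
  by rewrite integral_dirac// diracT mul1e.
exists (cons_sfmeasure mu) => f mf f0 /=.
rewrite integral_cons_sfmeasure//; apply: eq_integral => x _; apply: muE => //.
apply: (measurableT_comp mf).
exact: measurable_cons.
Qed.

Definition Rn_measure n := projT1 (cid (Rn_measure_ex n)).

Lemma Rn_integralE n (f : n.-tuple R -> \bar R) :
  measurable_fun setT f -> (forall x, 0 <= f x)%E ->
  Rn_integral f = (\int[Rn_measure n]_x f x)%E.
Proof. by move=> mf f0; rewrite /Rn_measure; case: cid => mu /= ->. Qed.

End Rn_measure.

(** * Iterated integrals: crude bounds without measurability, Fubini with it *)

Section Rn_integral_theory.
Context (R : realType).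
Notation leb := (@lebesgue_measure R).
Local Open Scope ereal_scope.

Lemma Rn_integral_ge0 n (f : n.-tuple R -> \bar R) :
  (forall x, 0 <= f x) -> 0 <= Rn_integral f.
Proof.
elim: n f => [|n IH] f f0 /=; first exact: f0.
by apply: integral_ge0 => x _; apply: IH.
Qed.

Lemma nonneg_le_Rn_integral n (f g : n.-tuple R -> \bar R) :
  (forall x, 0 <= f x) -> (forall x, f x <= g x) ->
  Rn_integral f <= Rn_integral g.
Proof.
elim: n f g => [|n IH] f g f0 fg /=; first exact: fg.
apply: nonneg_le_integral => x _; first by apply: Rn_integral_ge0.
by apply: IH.
Qed.

Lemma abse_integral_le2 d (T : measurableType d) (mu : {measure set T -> \bar R})
    (f : T -> \bar R) : `|\int[mu]_x f x| <= 2%:E * \int[mu]_x `|f x|.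
Proof.
rewrite integralE (le_trans (lee_abs_sub _ _))//.
rewrite !gee0_abs; try by apply: integral_ge0.
rewrite mule_natl mule2n; apply: leeD; apply: nonneg_le_integral => // x _.
  by rewrite -/((abse \o f) x) fune_abse leeDl.
by rewrite -/((abse \o f) x) fune_abse leeDr.
Qed.

Import HBNNSimple.

(** Also free of measurability: a simple function lies below k f exactly when its multiple by 1/k
    lies below f. It serves integrands such as [weighted_energy], and inner iterated integrals. *)
Lemma nonneg_integralZl_le d (T : measurableType d) (mu : {measure set T -> \bar R})
    (D : set T) (f : T -> \bar R) (k : R) : (forall x, D x -> 0 <= f x) -> (0 < k)%R ->
  \int[mu]_(x in D) (k%:E * f x) <= k%:E * \int[mu]_(x in D) f x.
Proof.
move=> fD0 k0; rewrite !(integral_mkcond D).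
have -> : (fun x => k%:E * f x) \_ D = (fun x => k%:E * (f \_ D) x).
  by apply/funext => x; rewrite !patchE; case: ifP => //; rewrite mule0.
have f0 x : 0 <= (f \_ D) x by apply: erestrict_ge0.
move: (f \_ D) f0 => {fD0}f f0.
rewrite ge0_integralTE; last by move=> x; rewrite mule_ge0// lee_fin ltW.
rewrite ge0_integralTE//.
apply: ge_ereal_sup => _ [h hf <-].
have k1 : (0 <= k^-1)%R by rewrite invr_ge0 ltW.
pose h' := scale_nnsfun h k1.
have -> : sintegral mu h = k%:E * sintegral mu h'.
  have -> : sintegral mu h' = (k^-1)%:E * sintegral mu h.
    by rewrite -sintegralrM; apply: eq_sintegral => x /=; rewrite mulrC.
  by rewrite muleA -EFinM divff ?gt_eqF// mul1e.
rewrite lee_pmul2l ?lte_fin//.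
apply: ereal_sup_ubound; exists h' => // x /=.
rewrite -(@lee_pmul2l _ k%:E) ?lte_fin// -EFinM mulrA divff ?gt_eqF// mul1r.
exact: hf.
Qed.

Lemma abse_Rn_integral_le n (f : n.-tuple R -> \bar R) :
  `|Rn_integral f| <= (2 ^+ n)%:E * Rn_integral (fun x => `|f x|).
Proof.
elim: n f => [|n IH] f /=; first by rewrite expr0 mul1e.
apply: (le_trans (abse_integral_le2 _ _)).
rewrite exprS EFinM -muleA; apply: lee_pmul => //.
  exact: integral_ge0.
apply: le_trans (nonneg_integralZl_le _ _ _).
- by apply: nonneg_le_integral => x _.
- by move=> x _; apply: Rn_integral_ge0.
- by rewrite exprn_gt0.
Qed.

(** The parameter space T is arbitrary because the induction moves the first coordinate into the
    parameter. *)
Lemma measurable_Rn_integral n d (T : measurableType d) (g : T * n.-tuple R -> \bar R) :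
  measurable_fun setT g -> measurable_fun setT (fun y => Rn_integral (fun t => g (y, t))).
Proof.
elim: n d T g => [|n IH] d T g mg /=.
  apply: (measurableT_comp mg); apply: measurable_fun_pair => /=; first exact: measurable_id.
  exact: measurable_cst.
pose h (z : T * measurableTypeR R) := Rn_integral (fun t => g (z.1, cons_tuple z.2 t)).
have mh : measurable_fun setT h.
  apply: (IH _ _ (fun z : (T * measurableTypeR R) * n.-tuple R => g (z.1.1, cons_tuple z.1.2 z.2))).
  apply: (measurableT_comp mg); apply: measurable_fun_pair => /=.
    by apply: measurableT_comp; exact: measurable_fst.
  apply: measurable_cons => //.
  by apply: measurableT_comp; [exact: measurable_snd|exact: measurable_fst].
exact: (measurable_integral_param _ mh).
Qed.

Lemma integral_Rn_measureS n (f : n.+1.-tuple R -> \bar R) :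
  measurable_fun setT f -> (forall x, 0 <= f x) ->
  \int[Rn_measure R n.+1]_x f x =
  \int[leb]_x \int[Rn_measure R n]_t f (cons_tuple x t).
Proof.
move=> mf f0; rewrite -Rn_integralE//=; apply: eq_integral => x _.
rewrite Rn_integralE//.
by apply: (measurableT_comp mf); exact: measurable_cons.
Qed.

(** Sections of a signed f are integrable only for almost every first coordinate. The integrals A
    and B of the positive and negative parts of the sections are integrable, hence finite a.e.;
    where both are finite, the induction hypothesis identifies the inner iterated integral with A -
    B. *)
Lemma integrable_Rn_integralE n (f : n.-tuple R -> \bar R) :
  (Rn_measure R n).-integrable setT f ->
  Rn_integral f = \int[Rn_measure R n]_x f x.
Proof.
elim: n f => [|n IH] f intf.
  have mf := measurable_int _ intf.
  rewrite [RHS]integralE -!Rn_integralE//=; last 2 first.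
  - exact: measurable_funeneg.
  - exact: measurable_funepos.
  by rewrite {1}(funeposneg f).
have mf := measurable_int _ intf.
have mfp := measurable_funepos mf; have mfn := measurable_funeneg mf.
have mc (h : n.+1.-tuple R -> \bar R) : measurable_fun setT h ->
    measurable_fun setT (fun z : measurableTypeR R * n.-tuple R => h (cons_tuple z.1 z.2)).
  move=> mh; apply: (measurableT_comp mh).
  exact: measurable_cons measurable_fst measurable_snd.
have mcx (h : n.+1.-tuple R -> \bar R) x : measurable_fun setT h ->
    measurable_fun setT (fun t => h (cons_tuple x t)).
  move=> mh; apply: (measurableT_comp mh).
  exact: measurable_cons.
pose A x := \int[Rn_measure R n]_t f^\+ (cons_tuple x t).
pose B x := \int[Rn_measure R n]_t f^\- (cons_tuple x t).
have mA : measurable_fun setT (A : measurableTypeR R -> _).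
  exact: (measurable_fun_fubini_tonelli_F
    (fun z : measurableTypeR R * n.-tuple R => f^\+ (cons_tuple z.1 z.2)) (mc _ mfp)).
have mB : measurable_fun setT (B : measurableTypeR R -> _).
  exact: (measurable_fun_fubini_tonelli_F
    (fun z : measurableTypeR R * n.-tuple R => f^\- (cons_tuple z.1 z.2)) (mc _ mfn)).
have A0 x : 0 <= A x by apply: integral_ge0.
have B0 x : 0 <= B x by apply: integral_ge0.
have intA : leb.-integrable setT A.
  apply/integrableP; split => //.
  under eq_integral do rewrite gee0_abs//.
  by rewrite -integral_Rn_measureS//; exact: integral_funepos_lt_pinfty.
have intB : leb.-integrable setT B.
  apply/integrableP; split => //.
  under eq_integral do rewrite gee0_abs//.
  by rewrite -integral_Rn_measureS//; exact: integral_funeneg_lt_pinfty.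
rewrite [RHS]integralE !integral_Rn_measureS// -(integralB _ intA intB)//=.
apply: ae_eq_integral => //.
- apply: (measurable_Rn_integral (T := measurableTypeR R)
    (g := fun z => f (cons_tuple z.1 z.2))).
  exact: mc.
- exact: emeasurable_funB.
have /= := integrable_ae measurableT intA; apply: filterS2 (integrable_ae measurableT intB).
move=> x /(_ Logic.I) Bfin /(_ Logic.I) Afin _.
rewrite IH.
  by rewrite -[fun t => f _]/(f \o cons_tuple x) [LHS]integralE funepos_comp funeneg_comp.
apply/integrableP; split; first exact: mcx.
have Eabs t : `|f (cons_tuple x t)| = f^\+ (cons_tuple x t) + f^\- (cons_tuple x t).
  by rewrite -[LHS]/((abse \o f) (cons_tuple x t)) fune_abse.
under eq_integral do rewrite Eabs.
rewrite ge0_integralD//; [|exact: mcx|exact: mcx].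
by rewrite lte_add_pinfty// -ge0_fin_numE ?A0 ?B0.
Qed.

Lemma Rn_integralZl n (f : n.-tuple R -> \bar R) (k : \bar R) :
  measurable_fun setT f -> (forall x, 0 <= f x) -> 0 <= k ->
  Rn_integral (fun x => k * f x) = k * Rn_integral f.
Proof.
move=> mf f0 k0; rewrite !Rn_integralE//; first exact: ge0_integralZl.
  by apply: emeasurable_funM => //; exact: measurable_cst.
by move=> x; exact: mule_ge0.
Qed.

Lemma tnth_cons0 n (x : R) (t : n.-tuple R) : tnth (cons_tuple x t) ord0 = x.
Proof. by []. Qed.

Lemma measurable_prodr d (T : measurableType d) (I : Type) (s : seq I) (P : pred I)
    (h : I -> T -> R) :
  (forall i, measurable_fun setT (h i)) ->
  measurable_fun setT (fun x => \prod_(i <- s | P i) h i x)%R.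
Proof.
move=> mh; elim: s => [|i s IH].
  by rewrite (_ : (fun _ => _) = cst 1%R)//; apply/funext => x; rewrite big_nil.
rewrite (_ : (fun _ => _) =
  (fun x => (if P i then h i x else 1) * \prod_(j <- s | P j) h j x)%R).
  apply: measurable_funM => //; case: (P i) => //; exact: measurable_cst.
by apply/funext => x; rewrite big_cons; case: (P i); rewrite ?mul1r.
Qed.

Lemma Rn_integral_prod n (phi : 'I_n -> R -> R) :
  (forall i, measurable_fun setT (phi i)) -> (forall i x, (0 <= phi i x)%R) ->
  Rn_integral (fun x => (\prod_(i < n) phi i (tnth x i))%:E) =
  \prod_(i < n) \int[leb]_x (phi i x)%:E.
Proof.
elim: n phi => [|n IH] phi mphi phi0 /=; first by rewrite !big_ord0.
have mprod : measurable_fun setT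
    (fun t : n.-tuple R => (\prod_(i < n) phi (lift ord0 i) (tnth t i))%:E).
  apply/measurable_EFinP; apply: measurable_prodr => i.
  by apply: measurableT_comp => //; exact: measurable_tnth.
have prod0 (t : n.-tuple R) : 0 <= (\prod_(i < n) phi (lift ord0 i) (tnth t i))%:E.
  by rewrite lee_fin prodr_ge0.
rewrite big_ord_recl -IH//.
rewrite -ge0_integralZr//; last 3 first.
- by have /measurable_EFinP := mphi ord0.
- by move=> x _; rewrite lee_fin.
- exact: Rn_integral_ge0.
apply: eq_integral => x _; rewrite -Rn_integralZl//; last by rewrite lee_fin.
congr Rn_integral; apply/funext => t; rewrite big_ord_recl tnth_cons0 EFinM.
by congr (_ * _%:E); apply: eq_bigr => i _; rewrite tnthS.
Qed.

End Rn_integral_theory.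

(** * One-dimensional integrals *)

Section calculus.
Context (R : realType).
Notation leb := (@lebesgue_measure R).

Lemma derive_continuous_at (F : R -> R) (x l : R) : is_derive x 1 F l -> {for x, continuous F}.
Proof. by move=> dF; apply/differentiable_continuous/derivable1_diffP; exact: ex_derive. Qed.

Lemma integral_itv_primitive (f F : R -> R) (a b : R) : a < b ->
  (forall x, a <= x <= b -> {for x, continuous f}) ->
  (forall x, a <= x <= b -> is_derive x 1 F (f x)) ->
  (\int[leb]_(x in `[a, b]) (f x)%:E = (F b - F a)%:E)%E.
Proof.
move=> ab cf dF; rewrite (@continuous_FTC2 _ f F)//.
- apply: continuous_in_subspaceT => x /[!inE] /=; rewrite in_itv/= => xab; exact: cf.
- split.
  + by move=> x; rewrite in_itv/= => /andP[ax xb]; apply: ex_derive; apply: dF; rewrite !ltW.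
  + by apply: cvg_at_right_filter; apply: (derive_continuous_at (dF a _)); rewrite lexx ltW.
  + by apply: cvg_at_left_filter; apply: (derive_continuous_at (dF b _)); rewrite lexx ltW.
- move=> x; rewrite in_itv/= => /andP[ax xb].
  by rewrite derive1E; apply: derive_val; apply: dF; rewrite !ltW.
Qed.

(** No limit of F at the ends of D is required, only a uniform bound on its increments: the
    fundamental theorem applies on nested compact intervals, and monotone convergence passes to D.
    This covers the whole line and a half line with a singularity at 0. *)
Lemma integral_le_primitive (f F : R -> R) (B : R) (a b : nat -> R) (D : set R) :
  D = \bigcup_k `[a k, b k]%classic -> (forall k, a k < b k) ->
  {homo a : i j / (i <= j)%N >-> j <= i} -> {homo b : i j / (i <= j)%N >-> i <= j} ->
  (forall x, D x -> 0 <= f x) -> (forall x, D x -> {for x, continuous f}) ->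
  (forall x, D x -> is_derive x 1 F (f x)) ->
  (forall x y, D x -> D y -> F y - F x <= B) ->
  (\int[leb]_(x in D) (f x)%:E <= B%:E)%E.
Proof.
move=> DE ab nia ndb f0 cf dF FB.
have Dab k x : a k <= x <= b k -> D x.
  by move=> xk; rewrite DE; exists k => //=; rewrite in_itv.
have mf k : measurable_fun (`[a k, b k] : set R) (EFin \o f).
  apply/measurable_EFinP; apply: subspace_continuous_measurable_fun => //.
  by apply: continuous_in_subspaceT => x /[!inE] /=; rewrite in_itv/= => /Dab; exact: cf.
have /cvg_lim <- : (\int[leb]_(x in `[a k, b k]) (f x)%:E @[k --> \oo] -->
    \int[leb]_(x in D) (f x)%:E)%E; last exact: ereal_hausdorff.
  rewrite DE; apply: ge0_nondecreasing_set_cvg_integral => //.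
  - move=> i j ij; apply/subsetPset => x /=; rewrite !in_itv/= => /andP[ax xb].
    by rewrite (le_trans (nia _ _ ij))// (le_trans xb)// ndb.
  - by move=> i x /=; rewrite in_itv/= => /Dab Dx; rewrite lee_fin f0.
apply: lime_le.
  apply: ereal_nondecreasing_is_cvgn => i j ij; apply: ge0_subset_integral => //.
  - exact: mf.
  - by move=> x /=; rewrite in_itv/= => /Dab Dx; rewrite lee_fin f0.
  - move=> x /=; rewrite !in_itv/= => /andP[ax xb].
    by rewrite (le_trans (nia _ _ ij))// (le_trans xb)// ndb.
apply: nearW => k.
rewrite (integral_itv_primitive (ab k) (fun x xk => cf x (Dab k x xk))
  (fun x xk => dF x (Dab k x xk))).
by rewrite lee_fin; apply: FB; apply: (Dab k); rewrite lexx ltW.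
Qed.

Lemma setT_bigcup_itv : [set: R] = \bigcup_k `[- k.+1%:R, k.+1%:R]%classic.
Proof.
apply/seteqP; split => // x _; exists (Num.truncn `|x|) => //=.
by rewrite in_itv/= -ler_norml ltW// truncnS_gt.
Qed.

(** With k.+2 in place of k.+1 the interval for k = 0 is nondegenerate, as [integral_le_primitive]
    requires. *)
Lemma itv0y_bigcup_itv : `]0, +oo[%classic = \bigcup_k `[k.+2%:R^-1, k.+2%:R]%classic :> set R.
Proof.
apply/seteqP; split => [x|x [k _]] /=; rewrite !in_itv/= ?andbT; last first.
  by move=> /andP[+ _]; apply: lt_le_trans; rewrite invr_gt0 ltr0n.
move=> x0; exists (maxn (Num.truncn x) (Num.truncn x^-1)) => //=; rewrite in_itv/=; apply/andP; split.
  rewrite -[leRHS]invrK lef_pV2 ?posrE ?invr_gt0 ?ltr0n//.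
  rewrite (le_trans (ltW (truncnS_gt _)))// ler_nat ltnS.
  by rewrite (leq_trans (leq_maxr (Num.truncn x) _)).
rewrite (le_trans (ltW (truncnS_gt _)))// ler_nat ltnS.
by rewrite (leq_trans (leq_maxl _ (Num.truncn x^-1))).
Qed.

(** The Poisson kernel in the normalisation of exp(- 2 pi i x.xi). Its primitive is atan / pi up to
    an affine change of variable, and atan oscillates by less than pi. *)
Lemma integral_poisson_le (e c : R) : 0 < e ->
  (\int[leb]_y (2 * e / (e ^+ 2 + (2 * pi * (c - y)) ^+ 2))%:E <= 1%:E)%E.
Proof.
move=> e0.
have pi0 := pi_gt0 R.
pose u (y : R) : R := (2 * pi / e) * (y - c).
have den0 y : 0 < e ^+ 2 + (2 * pi * (c - y)) ^+ 2.
  by rewrite ltr_wpDr ?sqr_ge0// exprn_gt0.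
apply: (@integral_le_primitive _ (fun y => pi^-1 * atan (u y)) 1
  (fun k => - k.+1%:R) (fun k => k.+1%:R)).
- exact: setT_bigcup_itv.
- by move=> k; rewrite (@lt_trans _ _ 0)// ltrNl oppr0.
- by move=> i j ij; rewrite lerN2 ler_nat.
- by move=> i j ij; rewrite ler_nat.
- by move=> y _; rewrite divr_ge0// ?mulr_ge0// ltW.
- move=> y _; apply: cvgM; first exact: cvg_cst.
  apply: cvgV; first by rewrite gt_eqF.
  apply: cvgD; first exact: cvg_cst.
  apply: (@continuous_comp _ _ _ (fun z : R => 2 * pi * (c - z)) (fun w => w ^+ 2)).
    by apply: cvgM; [exact: cvg_cst|apply: cvgB; [exact: cvg_cst|exact: cvg_id]].
  exact: exprn_continuous.
- move=> y _; rewrite /u; apply: is_derive_eq.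
  rewrite /GRing.scale /=.
  move: (den0 y) pi0; move: (@pi R) => p dp p0; field.
  by rewrite !gt_eqF.
- move=> x y _ _.
  have := atan_ltpi2 (u y); have := atan_gtNpi2 (u x) => h1 h2.
  rewrite -mulrBr mulrC ler_pdivrMr// mul1r.
  lra.
Qed.

(** A majorant uniform in m which, divided by sqrt x, has an elementary primitive; this avoids the
    Gamma function. Below d the exponential is at most 1, above d it is at most d / x, and (sqrt d +
    sqrt x)^2 is at most 2 (d + x) throughout. *)
Lemma expRN_sqrt_le (x d : R) (m : nat) : (0 < m)%N -> 0 < d -> 0 < x ->
  expR (- (x / d) ^+ m) <= 4 * d / (Num.sqrt d + Num.sqrt x) ^+ 2.
Proof.
move=> m0 d0 x0.
have sd0 : 0 < Num.sqrt d by rewrite sqrtr_gt0.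
have sx0 : 0 < Num.sqrt x by rewrite sqrtr_gt0.
have sdE : Num.sqrt d ^+ 2 = d by rewrite sqr_sqrtr// ltW.
have sxE : Num.sqrt x ^+ 2 = x by rewrite sqr_sqrtr// ltW.
have s2 : (Num.sqrt d + Num.sqrt x) ^+ 2 <= 2 * (d + x).
  rewrite -subr_ge0 (_ : _ - _ = (Num.sqrt d - Num.sqrt x) ^+ 2) ?sqr_ge0//.
  by rewrite -[d in 2 * (d + _)]sdE -[x in 2 * (_ + x)]sxE; ring.
have xd0 : 0 <= x / d by rewrite divr_ge0// ltW.
rewrite ler_pdivlMr ?exprn_gt0 ?addr_gt0//.
have [xd|dx] := leP x d.
  have e1 : expR (- (x / d) ^+ m) <= 1 by rewrite -expR0 ler_expR oppr_le0 exprn_ge0.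
  rewrite (@le_trans _ _ (1 * (Num.sqrt d + Num.sqrt x) ^+ 2))//.
    by rewrite ler_wpM2r// sqr_ge0.
  by nra.
have xd1 : 1 <= x / d by rewrite ler_pdivlMr// mul1r ltW.
have e1 : expR (- (x / d) ^+ m) <= d / x.
  rewrite -[leRHS]invrK expRN lef_pV2 ?posrE ?expR_gt0 ?invr_gt0 ?divr_gt0//.
  rewrite invf_div (le_trans (ler_eXnr m0 xd1))//.
  by rewrite (le_trans _ (expR_ge1Dx _))// lerDr.
rewrite (@le_trans _ _ (d / x * (2 * (d + x))))//.
  by apply: ler_pM => //; rewrite ?expR_ge0 ?sqr_ge0.
rewrite mulrAC ler_pdivrMr//.
nra.
Qed.

(** Used twice: with m = n for the frequency integral, one coordinate at a time, and with m = 1 for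
    the time integral. *)
Lemma integral_expRN_sqrt_le (d : R) (m : nat) : (0 < m)%N -> 0 < d ->
  (\int[leb]_(x in `]0%R, +oo[) (expR (- (x / d) ^+ m) / Num.sqrt x)%:E <=
   (8 * Num.sqrt d)%:E)%E.
Proof.
move=> m0 d0.
have sd0 : 0 < Num.sqrt d by rewrite sqrtr_gt0.
have sx0 (x : R) : 0 < x -> 0 < Num.sqrt x by rewrite sqrtr_gt0.
have sdE : Num.sqrt d ^+ 2 = d by rewrite sqr_sqrtr// ltW.
pose f (x : R) : R := 4 * d / ((Num.sqrt d + Num.sqrt x) ^+ 2 * Num.sqrt x).
apply: (@le_trans _ _ (\int[leb]_(x in `]0%R, +oo[) (f x)%:E)%E).
  apply: nonneg_le_integral => x /=; rewrite in_itv/= andbT => x0; rewrite lee_fin.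
    by rewrite divr_ge0 ?expR_ge0 ?sqrtr_ge0.
  rewrite /f invfM mulrA ler_wpM2r ?invr_ge0 ?sqrtr_ge0//.
  exact: expRN_sqrt_le.
pose F (x : R) : R := 8 * Num.sqrt d * (1 - Num.sqrt d / (Num.sqrt d + Num.sqrt x)).
have den0 (x : R) : 0 < Num.sqrt d + Num.sqrt x by rewrite ltr_wpDr ?sqrtr_ge0.
apply: (@integral_le_primitive _ F (8 * Num.sqrt d) (fun k => k.+2%:R^-1)
  (fun k => k.+2%:R)).
- exact: itv0y_bigcup_itv.
- move=> k; rewrite (@lt_trans _ _ 1)// ?ltr1n// invf_lt1 ?ltr1n// ltr0n//.
- by move=> i j ij; rewrite lef_pV2 ?posrE ?ltr0n// ler_nat.
- by move=> i j ij; rewrite ler_nat.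
- move=> x _; rewrite divr_ge0// ?mulr_ge0 ?sqr_ge0 ?sqrtr_ge0//; exact: ltW.
- move=> x /=; rewrite in_itv/= andbT => x0.
  apply: cvgM; first exact: cvg_cst.
  apply: cvgV; first by rewrite gt_eqF// mulr_gt0 ?exprn_gt0 ?sx0.
  apply: cvgM; last exact: sqrt_continuous.
  apply: (@continuous_comp _ _ _ (fun z : R => Num.sqrt d + Num.sqrt z) (fun w => w ^+ 2)).
    by apply: cvgD; [exact: cvg_cst|exact: sqrt_continuous].
  exact: exprn_continuous.
- move=> x /=; rewrite in_itv/= andbT => x0; rewrite /F /f.
  have dsx := is_derive1_sqrt x0.
  have dD : is_derive x 1 (fun y => Num.sqrt d + Num.sqrt y) (2 * Num.sqrt x)^-1.
    rewrite -[X in is_derive _ _ _ X]add0r.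
    exact: (is_deriveD (is_derive_cst (Num.sqrt d) x 1) dsx).
  have dV := @is_deriveV _ (fun y => Num.sqrt d + Num.sqrt y) x _ _ (lt0r_neq0 (den0 x)) dD.
  apply: is_derive_eq.
  rewrite /GRing.scale /= -[d in 4 * d]sdE.
  move: (den0 x) (sx0 _ x0) sd0; move: (Num.sqrt d) (Num.sqrt x) => a b ab b0 a0.
  field.
  by rewrite !gt_eqF.
- move=> x y _ _; rewrite /F.
  have q0 z : 0 <= Num.sqrt d / (Num.sqrt d + Num.sqrt z) <= 1.
    rewrite ler_pdivrMr// mul1r lerDl sqrtr_ge0 andbT.
    by rewrite divr_ge0 ?sqrtr_ge0// ltW.
  have /andP[x0 x1] := q0 x; have /andP[y0 y1] := q0 y.
  rewrite -mulrBr -[leRHS]mulr1 ler_pM2l ?mulr_gt0//.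
  lra.
Qed.

End calculus.

(** * Cosine integrals of exp(- e |x|) *)

Section laplace.
Context (R : realType).
Notation leb := (@lebesgue_measure R).

Lemma continuous_cos_affine (th b x : R) : {for x, continuous (fun y : R => cos (th + b * y))}.
Proof.
apply: (@continuous_comp _ _ _ (fun y : R => th + b * y)); last exact: continuous_cos.
by apply: cvgD; [exact: cvg_cst|apply: cvgM; [exact: cvg_cst|exact: cvg_id]].
Qed.

Lemma continuous_expRN_scale (e x : R) : {for x, continuous (fun y : R => expR (- (e * y)))}.
Proof.
apply: (@continuous_comp _ _ _ (fun y : R => - (e * y))); last exact: continuous_expR.
by apply: cvgN; apply: cvgM; [exact: cvg_cst|exact: cvg_id].
Qed.

Lemma cvgy_expRN_scale (e : R) : 0 < e -> expR (- (e * x)) @[x --> +oo] --> (0 : R).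
Proof.
move=> e0.
apply: (@cvg_comp _ _ _ (fun x : R => e * x) (fun y => expR (- y))); last exact: cvgr_expR.
exact: gt0_cvgMry.
Qed.

(** The summand 1 makes the integrand nonnegative, as the improper fundamental theorem demands; it
    is subtracted again in [integral_expRN_norm_cos]. The phase th will absorb the other
    coordinates. *)
Lemma integral_laplace_cos (e th b : R) : 0 < e ->
  (\int[leb]_(x in `[0%R, +oo[) (expR (- (e * x)) * (1 + cos (th + b * x)))%:E =
   (e^-1 + (e * cos th - b * sin th) / (e ^+ 2 + b ^+ 2))%:E)%E.
Proof.
move=> e0.
have den0 : 0 < e ^+ 2 + b ^+ 2 by rewrite ltr_wpDr ?sqr_ge0// exprn_gt0.
(* From integrating exp(- e x) cos (th + b x) by parts twice; the term - 1/e accounts for the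
   summand 1. *)
pose q (x : R) : R := - e^-1 + (- e * cos (th + b * x) + b * sin (th + b * x)) / (e ^+ 2 + b ^+ 2).
pose F (x : R) : R := expR (- (e * x)) * q x.
have dF (x : R) : is_derive x 1 F (expR (- (e * x)) * (1 + cos (th + b * x))).
  apply: is_derive_eq; rewrite /GRing.scale /= /q.
  field.
  by rewrite !gt_eqF.
have cf (x : R) : {for x, continuous (fun x : R => expR (- (e * x)) * (1 + cos (th + b * x)))}.
  apply: cvgM; first exact: continuous_expRN_scale.
  by apply: cvgD; [exact: cvg_cst|exact: continuous_cos_affine].
rewrite (@ge0_continuous_FTC2y _ _ F _ 0).
- rewrite -EFinB; congr EFin; rewrite /F /q !mulr0 oppr0 expR0 addr0; lra.
- by move=> x _; rewrite mulr_ge0 ?expR_ge0// -lerBlDl sub0r; exact: cos_geN1.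
- apply: continuous_subspaceT => x; exact: cf.
- pose C := e^-1 + (e + `|b|) / (e ^+ 2 + b ^+ 2).
  apply: (@squeeze_cvgr _ _ _ _ (fun x => - (C * expR (- (e * x)))) (fun x => C * expR (- (e * x)))).
  + apply: nearW => x; rewrite -ler_norml /F normrM (ger0_norm (expR_ge0 _)) mulrC ler_wpM2r ?expR_ge0//.
    rewrite (le_trans (ler_normD _ _))// normrN (gtr0_norm) ?invr_gt0// lerD2l.
    rewrite normrM normfV (gtr0_norm den0) ler_wpM2r ?invr_ge0 ?(ltW den0)//.
    rewrite (le_trans (ler_normD _ _))// !normrM normrN (gtr0_norm e0) lerD//.
      by rewrite -[leRHS]mulr1 ler_wpM2l ?(ltW e0)// ler_norml cos_geN1 cos_le1.
    by rewrite -[leRHS]mulr1 ler_wpM2l// ler_norml sin_geN1 sin_le1.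
  + rewrite -oppr0; apply: cvgN; rewrite -(mulr0 C); apply: cvgM; first exact: cvg_cst.
    exact: cvgy_expRN_scale.
  + rewrite -(mulr0 C); apply: cvgM; first exact: cvg_cst.
    exact: cvgy_expRN_scale.
- by move=> x _; apply: ex_derive.
- by apply: cvg_at_right_filter; exact: derive_continuous_at (dF 0).
- by move=> x _; rewrite derive1E; exact: derive_val.
Qed.

(** Reflecting the negative half line replaces b by - b, so the two sine terms cancel and the cosine
    terms double. *)
Lemma integral_bilateral_laplace_cos (e th b : R) : 0 < e ->
  (\int[leb]_x (expR (- (e * `|x|)) * (1 + cos (th + b * x)))%:E =
   (2 * e^-1 + 2 * (e * cos th) / (e ^+ 2 + b ^+ 2))%:E)%E.
Proof.
move=> e0.
pose f (x : R) : R := expR (- (e * `|x|)) * (1 + cos (th + b * x)).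
have f0 x : 0 <= f x by rewrite mulr_ge0 ?expR_ge0// -lerBlDl sub0r; exact: cos_geN1.
have cf : continuous f.
  move=> x; apply: cvgM.
    apply: (@continuous_comp _ _ _ (@Num.norm _ R) (fun y : R => expR (- (e * y)))).
      exact: norm_continuous.
    exact: continuous_expRN_scale.
  by apply: cvgD; [exact: cvg_cst|exact: continuous_cos_affine].
have mf : measurable_fun setT f by exact: continuous_measurable_fun.
rewrite -[in LHS](setUv `[0%R, +oo[%classic) ge0_integral_setU//=; last 3 first.
- exact: measurableC.
- by rewrite setUv; apply/measurable_EFinP.
- by apply/disj_setPCl.
rewrite setCitvr integral_itv_bndo_bndc; last by apply/measurable_EFinP/measurable_funTS.
rewrite -{2}oppr0 ge0_integration_by_substitutionNy//; last first.
- exact: continuous_subspaceT.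
have -> : (\int[leb]_(x in `[0%R, +oo[) ((f \o -%R) x)%:E =
    (e^-1 + (e * cos th - (- b) * sin th) / (e ^+ 2 + (- b) ^+ 2))%:E)%E.
  rewrite -integral_laplace_cos//; apply: eq_integral => x; rewrite inE/= in_itv/= andbT => x0.
  by rewrite /f /= normrN ger0_norm// mulrN mulNr.
have -> : (\int[leb]_(x in `[0%R, +oo[) (f x)%:E =
    (e^-1 + (e * cos th - b * sin th) / (e ^+ 2 + b ^+ 2))%:E)%E.
  rewrite -integral_laplace_cos//; apply: eq_integral => x; rewrite inE/= in_itv/= andbT => x0.
  by rewrite /f /= ger0_norm.
rewrite -EFinD; congr EFin; rewrite sqrrN; lra.
Qed.

Lemma measurable_expRN_norm (e : R) :
  measurable_fun setT (fun x : R => expR (- (e * `|x|))).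
Proof.
apply: continuous_measurable_fun => x.
apply: (@continuous_comp _ _ _ (@Num.norm _ R) (fun y : R => expR (- (e * y)))).
  exact: norm_continuous.
exact: continuous_expRN_scale.
Qed.

Lemma measurable_cos_affine (th b : R) :
  measurable_fun setT (fun x : R => cos (th + b * x)).
Proof. by apply: continuous_measurable_fun => x; exact: continuous_cos_affine. Qed.

(** The case th = b = 0 of the two-sided formula, where 1 + cos equals 2. *)
Lemma integral_expRN_norm (e : R) : 0 < e ->
  (\int[leb]_x (expR (- (e * `|x|)))%:E = (2 * e^-1)%:E)%E.
Proof.
move=> e0; have := integral_bilateral_laplace_cos 0 0 e0.
have E2 (x : R) : (expR (- (e * `|x|)) * (1 + cos (0 + 0 * x)))%:E =
    (2%:E * (expR (- (e * `|x|)))%:E)%E.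
  by rewrite mul0r add0r cos0 -EFinM mulrC.
under eq_integral do rewrite E2.
rewrite ge0_integralZl//=; last by apply/measurable_EFinP; exact: measurable_expRN_norm.
rewrite cos0 mulr1 expr0n addr0 => H.
have : (2^-1%:E * (2%:E * \int[leb]_x (expR (- (e * `|x|)))%:E) =
  2^-1%:E * (2 / e + 2 * e / e ^+ 2)%:E)%E by rewrite H.
rewrite muleA -!EFinM mulVf// mul1e => ->; congr EFin.
by field; rewrite gt_eqF.
Qed.

Lemma integrable_expRN_norm (e : R) : 0 < e ->
  leb.-integrable setT (fun x => (expR (- (e * `|x|)))%:E).
Proof.
move=> e0; apply/integrableP; split.
  by apply/measurable_EFinP; exact: measurable_expRN_norm.
under eq_integral do rewrite gee0_abs ?lee_fin ?expR_ge0//.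
by rewrite integral_expRN_norm// ltry.
Qed.

Lemma integral_expRN_norm_cos (e th b : R) : 0 < e ->
  (\int[leb]_x (expR (- (e * `|x|)) * cos (th + b * x))%:E =
   (cos th * (2 * e / (e ^+ 2 + b ^+ 2)))%:E)%E.
Proof.
move=> e0.
have mexp := measurable_expRN_norm e; have mcos := measurable_cos_affine th b.
have intb : leb.-integrable setT
    (EFin \o (fun x => expR (- (e * `|x|)) * (1 + cos (th + b * x)))).
  apply/integrableP; split.
    apply/measurable_EFinP; apply: measurable_funM => //.
    by apply: measurable_funD => //; exact: measurable_cst.
  under eq_integral do rewrite /= ger0_norm ?mulr_ge0 ?expR_ge0 -?lerBlDl ?sub0r ?cos_geN1//.
  by rewrite integral_bilateral_laplace_cos// ltry.
have E x : (expR (- (e * `|x|)) * cos (th + b * x))%:E =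
  ((expR (- (e * `|x|)) * (1 + cos (th + b * x)))%:E - (expR (- (e * `|x|)))%:E)%E.
  by rewrite -EFinB; congr EFin; rewrite mulrDr mulr1 addrAC subrr add0r.
under eq_integral do rewrite E.
rewrite integralB_EFin//; last exact: integrable_expRN_norm.
rewrite integral_expRN_norm// integral_bilateral_laplace_cos// -EFinB; congr EFin.
lra.
Qed.

End laplace.

(** * Schur's test and the Bessel inequality *)

Lemma integrable_prod_dominated d1 d2 (T1 : measurableType d1) (T2 : measurableType d2)
    (R : realType) (m1 : {sigma_finite_measure set T1 -> \bar R})
    (m2 : {sigma_finite_measure set T2 -> \bar R}) (u : T1 -> R) (v : T2 -> R)
    (h : T1 * T2 -> R) :
  m1.-integrable setT (EFin \o u) -> m2.-integrable setT (EFin \o v) ->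
  measurable_fun setT h -> (forall x y, `|h (x, y)| <= `|u x| * `|v y|) ->
  (m1 \x m2)%E.-integrable setT (EFin \o h).
Proof.
move=> /integrableP[/measurable_EFinP mu iu] /integrableP[/measurable_EFinP mv iv] mh huv.
apply/integrable12ltyP; first exact/measurable_EFinP.
have mnv : measurable_fun setT (fun y => `|v y|%:E).
  by apply/measurable_EFinP; exact: measurableT_comp.
have mnu : measurable_fun setT (fun y => `|u y|%:E).
  by apply/measurable_EFinP; exact: measurableT_comp.
apply: (@le_lt_trans _ _ (\int[m1]_x \int[m2]_y (`|u x|%:E * `|v y|%:E))%E).
  apply: nonneg_le_integral => x _; first exact: integral_ge0.
  by apply: nonneg_le_integral => y _ //; rewrite -EFinM lee_fin huv.
under eq_integral do rewrite ge0_integralZl//.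
rewrite ge0_integralZr//; last exact: integral_ge0.
by apply: lte_mul_pinfty => //; [exact: integral_ge0|rewrite ge0_fin_numE//; exact: integral_ge0].
Qed.

Section positive_kernel.
Context d1 d2 (X : measurableType d1) (Y : measurableType d2) (R : realType).
Variables (mu : {sigma_finite_measure set X -> \bar R})
  (nu : {sigma_finite_measure set Y -> \bar R}).
Variables (f : X -> R) (c s : X * Y -> R) (Psi : Y -> R) (k : X * X -> R) (K : R).
Hypothesis K_ge0 : 0 <= K.
Hypothesis intf : mu.-integrable setT (EFin \o f).
Hypotheses (mc : measurable_fun setT c) (ms : measurable_fun setT s).
Hypotheses (c1 : forall z, `|c z| <= 1) (s1 : forall z, `|s z| <= 1).
Hypotheses (Psi0 : forall y, 0 <= Psi y) (intPsi : nu.-integrable setT (EFin \o Psi)).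
Hypotheses (mk : measurable_fun setT k) (k0 : forall z, 0 <= k z)
  (ksym : forall x y, k (x, y) = k (y, x)).
Hypothesis kE : forall x y, (\int[nu]_xi
  (Psi xi * (c (x, xi) * c (y, xi) + s (x, xi) * s (y, xi)))%:E = (k (x, y))%:E)%E.
Hypothesis kK : forall x, (\int[mu]_y (k (x, y))%:E <= K%:E)%E.

Let mf : measurable_fun setT f.
Proof. by case/integrableP : intf => /measurable_EFinP. Qed.

Let mPsi : measurable_fun setT Psi.
Proof. by case/integrableP : intPsi => /measurable_EFinP. Qed.

Lemma integrable_modulated (g : X * Y -> R) (xi : Y) : measurable_fun setT g ->
  (forall z, `|g z| <= 1) -> mu.-integrable setT (EFin \o (fun x => f x * g (x, xi))).
Proof.
move=> mg g1; apply: (le_integrable _ _ _ intf) => //.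
  apply/measurable_EFinP; apply: measurable_funM => //.
  by apply: (measurableT_comp mg); exact: measurable_fun_pair.
by move=> x _ /=; rewrite lee_fin normrM -[leRHS]mulr1 ler_wpM2l.
Qed.

(** For the two choices of g made later, cosine and sine of 2 pi x.xi, these are the cosine and sine
    transforms of f. *)
Definition modulated_integral (g : X * Y -> R) (xi : Y) : R :=
  (\int[mu]_x (f x * g (x, xi)))%R.

Lemma modulated_integralE (g : X * Y -> R) (xi : Y) : measurable_fun setT g ->
  (forall z, `|g z| <= 1) ->
  ((modulated_integral g xi)%:E = \int[mu]_x (f x * g (x, xi))%:E)%E.
Proof.
move=> mg g1; rewrite /modulated_integral /Rintegral fineK//.
exact: (integrable_fin_num measurableT (integrable_modulated xi mg g1)).
Qed.

Lemma measurable_modulated_integral (g : X * Y -> R) : measurable_fun setT g ->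
  measurable_fun setT (modulated_integral g).
Proof.
move=> mg; apply: (measurableT_comp (fine_measurable measurableT)).
apply: (measurable_integral_param mu (g := fun z => (f z.2 * g (z.2, z.1))%:E)).
apply/measurable_EFinP; apply: measurable_funM.
  exact: measurableT_comp.
by apply: (measurableT_comp mg); exact: measurable_fun_pair.
Qed.

Lemma modulated_integral_le (g : X * Y -> R) (xi : Y) : measurable_fun setT g ->
  (forall z, `|g z| <= 1) ->
  `|modulated_integral g xi| <= (\int[mu]_x `|f x|)%R.
Proof.
move=> mg g1; apply: (le_trans (le_normr_Rintegral measurableT (integrable_modulated xi mg g1))).
apply: le_Rintegral => //.
- have := integrable_norm (integrable_modulated xi mg g1); exact.
- have := integrable_norm intf; exact.
- by move=> x _; rewrite normrM -[leRHS]mulr1 ler_wpM2l.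
Qed.

Let C := modulated_integral c.
Let S := modulated_integral s.
Let mC : measurable_fun setT C. Proof. exact: measurable_modulated_integral. Qed.
Let mS : measurable_fun setT S. Proof. exact: measurable_modulated_integral. Qed.
Let N1 := (\int[mu]_x `|f x|)%R.

Let cs_le (u v : R) z : `|u| <= N1 -> `|v| <= N1 -> `|c z * u + s z * v| <= 2 * N1.
Proof.
move=> uN vN; rewrite (le_trans (ler_normD _ _))// !normrM mulr2n mulrDl mul1r.
by rewrite lerD// -[leRHS]mul1r ler_pM.
Qed.

(** Of the two factors in C^2 and in S^2 only one is written out as an integral over x. Expanding
    one factor at a time means that Fubini is only ever applied to two variables. *)
Let H xi x := Psi xi * (f x * (c (x, xi) * C xi + s (x, xi) * S xi)).

Let mH : measurable_fun setT (fun z : Y * X => H z.1 z.2).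
Proof.
have mg (g : X * Y -> R) : measurable_fun setT g ->
    measurable_fun setT (fun z : Y * X => g (z.2, z.1)).
  by move=> mg; apply: (measurableT_comp mg); exact: measurable_fun_pair.
rewrite /H; apply: measurable_funM; first exact: measurableT_comp.
apply: measurable_funM; first exact: measurableT_comp.
apply: measurable_funD; apply: measurable_funM; do ?exact: mg; exact: measurableT_comp.
Qed.

Let square_as_integral xi :
  ((Psi xi * (C xi ^+ 2 + S xi ^+ 2))%:E = \int[mu]_x (H xi x)%:E)%E.
Proof.
have E x : (H xi x)%:E = ((Psi xi * C xi)%:E * (f x * c (x, xi))%:E +
    (Psi xi * S xi)%:E * (f x * s (x, xi))%:E)%E.
  by rewrite -!EFinM -EFinD /H; congr EFin; ring.
under eq_integral do rewrite E.
have ic := integrable_modulated xi mc c1.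
have is_ := integrable_modulated xi ms s1.
rewrite integralD//; try exact: integrableZl.
rewrite !integralZl// -!modulated_integralE// -!EFinM -EFinD; congr EFin.
by rewrite -/C -/S; ring.
Qed.

(** The second factor is expanded here, for fixed x, and [kE] then turns the xi-integral into the
    kernel k. *)
Let inner_integral x :
  (\int[nu]_xi (H xi x)%:E = \int[mu]_y (f x * f y * k (x, y))%:E)%E.
Proof.
pose G (z : Y * X) := f x * (f z.2 * (Psi z.1 *
  (c (x, z.1) * c (z.2, z.1) + s (x, z.1) * s (z.2, z.1)))).
have mg (g : X * Y -> R) : measurable_fun setT g ->
    measurable_fun setT (fun z : Y * X => g (z.2, z.1)).
  by move=> mg; apply: (measurableT_comp mg); exact: measurable_fun_pair.
have mgx (g : X * Y -> R) : measurable_fun setT g ->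
    measurable_fun setT (fun z : Y * X => g (x, z.1)).
  by move=> mgx; apply: (measurableT_comp mgx); exact: measurable_fun_pair.
have mG : measurable_fun setT G.
  apply: measurable_funM => //; apply: measurable_funM; first exact: measurableT_comp.
  apply: measurable_funM; first exact: measurableT_comp.
  by apply: measurable_funD; apply: measurable_funM; do ?exact: mg; exact: mgx.
have Gle xi y : `|G (xi, y)| <= `|Psi xi| * `|2 * `|f x| * f y|.
  rewrite /G /= !normrM normr_id (ger0_norm (ler0n _ 2)).
  set q := `|c _ * _ + _|.
  have q2 : q <= 2.
    rewrite /q (le_trans (ler_normD _ _))// !normrM mulr2n lerD// -[leRHS]mulr1 ler_pM//.
  rewrite [leLHS](_ : _ = `|Psi xi| * (`|f x| * `|f y|) * q); last by ring.
  rewrite [leRHS](_ : _ = `|Psi xi| * (`|f x| * `|f y|) * 2); last by ring.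
  by rewrite ler_wpM2l// mulr_ge0// mulr_ge0.
have iG : (nu \x mu)%E.-integrable setT (EFin \o G).
  apply: (integrable_prod_dominated intPsi _ mG Gle).
  have := integrableZl measurableT (2 * `|f x|) intf.
  exact.
transitivity (\int[nu]_xi \int[mu]_y (EFin \o G) (xi, y))%E.
  apply: eq_integral => xi _.
  have E y : (EFin \o G) (xi, y) = ((f x * Psi xi * c (x, xi))%:E * (f y * c (y, xi))%:E +
    (f x * Psi xi * s (x, xi))%:E * (f y * s (y, xi))%:E)%E.
    by rewrite /= -!EFinM -EFinD /G; congr EFin => /=; ring.
  under [RHS]eq_integral do rewrite E.
  have ic := integrable_modulated xi mc c1.
  have is_ := integrable_modulated xi ms s1.
  rewrite integralD//; try exact: integrableZl.
  rewrite !integralZl// -!modulated_integralE// -!EFinM -EFinD; congr EFin.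
  by rewrite /H -/C -/S; ring.
rewrite (Fubini iG); apply: eq_integral => y _.
have iP : nu.-integrable setT (EFin \o (fun xi =>
    Psi xi * (c (x, xi) * c (y, xi) + s (x, xi) * s (y, xi)))).
  have iP2 := integrableZl measurableT 2 intPsi.
  apply: (le_integrable _ _ _ iP2) => //.
    apply/measurable_EFinP; apply: measurable_funM => //.
    by apply: measurable_funD; apply: measurable_funM; apply: measurableT_comp => //;
      exact: measurable_fun_pair.
  move=> xi _ /=; rewrite lee_fin !normrM [leRHS]mulrC ler_wpM2l//.
  rewrite (le_trans (ler_normD _ _))// !normrM (ger0_norm (ler0n _ 2)) mulr2n.
  by rewrite lerD// -[leRHS]mulr1 ler_pM.
rewrite /G /=; under eq_integral do rewrite mulrA EFinM.
by rewrite integralZl// kE.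
Qed.

(** By two uses of Fubini the left side is the quadratic form of k at f, to which Schur's test
    applies. Integrability of f serves only to justify the exchanges; the bound does not involve its
    L^1 norm, so it survives the limit in the Abel weight. *)
Lemma positive_kernel_bessel :
  (\int[nu]_xi (Psi xi * (C xi ^+ 2 + S xi ^+ 2))%:E <= K%:E * \int[mu]_x (f x ^+ 2)%:E)%E.
Proof.
have intH : (nu \x mu)%E.-integrable setT (EFin \o (fun z : Y * X => H z.1 z.2)).
  have i2 := integrableZl measurableT (2 * N1) intf.
  apply: (integrable_prod_dominated intPsi i2 mH) => xi x /=.
  rewrite /H !normrM ler_wpM2l// [leRHS]mulrC ler_wpM2l//.
  rewrite (le_trans (cs_le _ _ _))//; try exact: modulated_integral_le.
  by rewrite -normrM ler_norm.
under eq_integral do rewrite square_as_integral.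
rewrite (Fubini intH) /=.
under eq_integral do rewrite inner_integral.
have mfst : measurable_fun setT (fun z : X * X => f z.1) by exact: measurableT_comp.
have msnd : measurable_fun setT (fun z : X * X => f z.2) by exact: measurableT_comp.
pose g1 (z : X * X) : \bar R := ((2^-1 * f z.1 ^+ 2)%:E * (k z)%:E)%E.
pose g2 (z : X * X) : \bar R := ((2^-1 * f z.2 ^+ 2)%:E * (k z)%:E)%E.
have mg1 : measurable_fun setT g1.
  apply: emeasurable_funM; last exact/measurable_EFinP.
  by apply/measurable_EFinP; apply: measurable_funM => //; exact: measurable_funX.
have mg2 : measurable_fun setT g2.
  apply: emeasurable_funM; last exact/measurable_EFinP.
  by apply/measurable_EFinP; apply: measurable_funM => //; exact: measurable_funX.
have g10 z : (0 <= g1 z)%E by rewrite /g1 -EFinM lee_fin mulr_ge0// mulr_ge0// sqr_ge0.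
have g20 z : (0 <= g2 z)%E by rewrite /g2 -EFinM lee_fin mulr_ge0// mulr_ge0// sqr_ge0.
have mx (h : X * X -> \bar R) x : measurable_fun setT h ->
    measurable_fun setT (fun y => h (x, y)).
  by move=> mh; apply: (measurableT_comp mh); exact: measurable_fun_pair.
have mffk : measurable_fun setT (fun z : X * X => (f z.1 * f z.2 * k z)%:E).
  apply/measurable_EFinP; apply: measurable_funM => //; exact: measurable_funM.
have half_le : (\int[mu]_x \int[mu]_y g1 (x, y) <=
    2^-1%:E * (K%:E * \int[mu]_x (f x ^+ 2)%:E))%E.
  have mf2 : measurable_fun setT (fun x => (f x ^+ 2)%:E).
    by apply/measurable_EFinP; exact: measurable_funX.
  have K0 : (0 <= K%:E)%E.
    by rewrite lee_fin.
  rewrite muleA -ge0_integralZl//; last 2 first.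
  - by move=> x _; rewrite lee_fin sqr_ge0.
  - by rewrite -EFinM lee_fin mulr_ge0.
  apply: nonneg_le_integral => x _; first exact: integral_ge0.
  rewrite /g1 /= ge0_integralZl//; last 3 first.
  - by apply: (mx (EFin \o k)); exact/measurable_EFinP.
  - by move=> y _; rewrite lee_fin.
  - by rewrite lee_fin mulr_ge0// sqr_ge0.
  apply: (@le_trans _ _ ((2^-1 * f x ^+ 2)%:E * K%:E)%E).
    by apply: lee_wpmul2l => //; rewrite lee_fin mulr_ge0// sqr_ge0.
  by rewrite -!EFinM lee_fin mulrAC.
(* Schur's test: |f(x) f(y)| k is at most the mean of f(x)^2 k and f(y)^2 k. Absolute values are
   taken first because the quadratic form is signed. *)
apply: (@le_trans _ _ (\int[mu]_x (\int[mu]_y g1 (x, y) + \int[mu]_y g2 (x, y))))%E.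
  apply: (le_trans (lee_abs _)); apply: (le_trans (le_abse_integral _ measurableT _)).
    exact: measurable_integral_param mffk.
  apply: nonneg_le_integral => // x _.
  apply: (le_trans (le_abse_integral _ measurableT _)); first exact: (mx _ x mffk).
  rewrite -ge0_integralD//; [|exact: mx|exact: mx].
  apply: nonneg_le_integral => // y _; rewrite /g1 /g2 /= -!EFinM -EFinD lee_fin.
  rewrite !normrM (ger0_norm (k0 _)) -mulrDl ler_wpM2r// -mulrDr.
  rewrite -(real_normK (num_real (f x))) -(real_normK (num_real (f y))) -subr_ge0.
  rewrite (_ : _ - _ = 2^-1 * (`|f x| - `|f y|) ^+ 2); last by field.
  by rewrite mulr_ge0// sqr_ge0.
rewrite ge0_integralD//; last 4 first.
- by move=> x _; exact: integral_ge0.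
- exact: measurable_integral_param.
- by move=> x _; exact: integral_ge0.
- exact: measurable_integral_param.
(* Tonelli and the symmetry of k exchange the two halves, so row sums suffice. *)
have -> : (\int[mu]_x \int[mu]_y g2 (x, y) = \int[mu]_x \int[mu]_y g1 (x, y))%E.
  rewrite fubini_tonelli//; apply: eq_integral => x _; apply: eq_integral => y _.
  by rewrite /g1 /g2 /= ksym.
apply: (le_trans (leeD half_le half_le)).
rewrite -ge0_muleDl ?lee_fin// -EFinD (_ : 2^-1 + 2^-1 = 1 :> R) ?mul1e//.
by field.
Qed.

End positive_kernel.

(** * Products of Poisson kernels and the Bessel inequality on R^n *)

Section bessel_Rn.
Context (R : realType).
Notation leb := (@lebesgue_measure R).

Lemma integrable_expRN_norm_cos (e th b : R) : 0 < e ->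
  leb.-integrable setT (fun x => (expR (- (e * `|x|)) * cos (th + b * x))%:E).
Proof.
move=> e0; apply: (le_integrable _ _ _ (integrable_expRN_norm e0)) => //.
  apply/measurable_EFinP; apply: measurable_funM; first exact: measurable_expRN_norm.
  exact: measurable_cos_affine.
move=> x _ /=; rewrite lee_fin normrM -[leRHS]mulr1 ler_wpM2l//.
by rewrite ler_norml cos_geN1 cos_le1.
Qed.

(** Arbitrary a and th make the induction close: integrating out the remaining coordinates treats
    the first one as part of the amplitude and of the phase. *)
Lemma Rn_integral_expRN_cos n (e th a : R) (w : 'I_n -> R) : 0 < e ->
  Rn_integral (fun xi : n.-tuple R => (a * (\prod_(i < n) expR (- (e * `|tnth xi i|)) *
     cos (th + \sum_(i < n) w i * tnth xi i)))%:E) =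
  (a * (cos th * \prod_(i < n) (2 * e / (e ^+ 2 + w i ^+ 2))))%:E.
Proof.
move=> e0; elim: n th a w => [|n IH] th a w /=.
  by rewrite !big_ord0 addr0 mul1r mulr1.
transitivity (\int[leb]_x ((a * \prod_(i < n) (2 * e / (e ^+ 2 + w (lift ord0 i) ^+ 2)))%:E *
   (expR (- (e * `|x|)) * cos (th + w ord0 * x))%:E))%E.
  apply: eq_integral => x _.
  transitivity (Rn_integral (fun xi : n.-tuple R => (a * expR (- (e * `|x|)) *
     (\prod_(i < n) expR (- (e * `|tnth xi i|)) *
     cos ((th + w ord0 * x) + \sum_(i < n) w (lift ord0 i) * tnth xi i)))%:E)).
    congr Rn_integral; apply/funext => t; congr EFin.
    rewrite !big_ord_recl !tnth_cons0 addrA !mulrA; congr (_ * _ * cos (_ + _)).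
      by apply: eq_bigr => i _; rewrite tnthS.
    by apply: eq_bigr => i _; rewrite tnthS.
  by rewrite IH -EFinM; congr EFin; ring.
rewrite integralZl//; last exact: integrable_expRN_norm_cos.
rewrite integral_expRN_norm_cos// -EFinM big_ord_recl; congr EFin; ring.
Qed.

Definition Abel_weight n (e : R) (xi : n.-tuple R) : R :=
  \prod_(i < n) expR (- (e * `|tnth xi i|)).

(** The Fourier transform of [Abel_weight] at x - y. *)
Definition Poisson_product n (e : R) (z : n.-tuple R * n.-tuple R) : R :=
  \prod_(i < n) (2 * e / (e ^+ 2 + (2 * pi * (tnth z.1 i - tnth z.2 i)) ^+ 2)).

Lemma Abel_weight_ge0 n (e : R) (xi : n.-tuple R) : 0 <= Abel_weight e xi.
Proof. by apply: prodr_ge0 => i _; exact: expR_ge0. Qed.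

Lemma Abel_weightE n (e : R) (xi : n.-tuple R) :
  Abel_weight e xi = expR (- (e * \sum_(i < n) `|tnth xi i|)).
Proof. by rewrite /Abel_weight -expR_sum mulr_sumr sumrN. Qed.

Lemma measurable_Abel_weight n (e : R) : measurable_fun setT (@Abel_weight n e).
Proof.
apply: measurable_prodr => i.
by apply: (measurableT_comp (measurable_expRN_norm e)); exact: measurable_tnth.
Qed.

Lemma integrable_Abel_weight n (e : R) : 0 < e ->
  (Rn_measure R n).-integrable setT (EFin \o @Abel_weight n e).
Proof.
move=> e0; have mA := @measurable_Abel_weight n e.
apply/integrableP; split; first exact/measurable_EFinP.
under eq_integral do rewrite /= ger0_norm ?Abel_weight_ge0//.
rewrite -Rn_integralE//; last 2 first.
- exact/measurable_EFinP.
- by move=> x; rewrite lee_fin Abel_weight_ge0.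
rewrite (Rn_integral_prod (phi := fun _ x => expR (- (e * `|x|)))); last 2 first.
- by move=> i; exact: measurable_expRN_norm.
- by move=> i x; exact: expR_ge0.
under eq_bigr do rewrite integral_expRN_norm//.
by rewrite prodEFin ltry.
Qed.

Lemma measurable_dotRn n :
  measurable_fun setT (fun z : n.-tuple R * n.-tuple R => dotRn z.1 z.2).
Proof.
apply: measurable_sum => i; apply: measurable_funM.
  by apply: (measurableT_comp (measurable_tnth i)); exact: measurable_fst.
by apply: (measurableT_comp (measurable_tnth i)); exact: measurable_snd.
Qed.

Lemma measurable_phase (g : R -> R) n : continuous g ->
  measurable_fun setT (fun z : n.-tuple R * n.-tuple R => g (2 * pi * dotRn z.1 z.2)).
Proof.
move=> cg; apply: measurableT_comp; first exact: continuous_measurable_fun.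
by apply: measurable_funM; [exact: measurable_cst|exact: measurable_dotRn].
Qed.

Lemma Poisson_den_gt0 (e u : R) : 0 < e -> 0 < e ^+ 2 + u ^+ 2.
Proof. by move=> e0; rewrite ltr_wpDr ?sqr_ge0// exprn_gt0. Qed.

Lemma Poisson_product_ge0 n (e : R) (z : n.-tuple R * n.-tuple R) : 0 < e ->
  0 <= Poisson_product e z.
Proof.
by move=> e0; apply: prodr_ge0 => i _; rewrite divr_ge0 ?mulr_ge0 ?(ltW (Poisson_den_gt0 _ _)) ?(ltW e0).
Qed.

Lemma measurable_Poisson_factor (e : R) : 0 < e ->
  measurable_fun setT (fun u : R => 2 * e / (e ^+ 2 + (2 * pi * u) ^+ 2)).
Proof.
move=> e0; apply: continuous_measurable_fun => x.
apply: cvgM; first exact: cvg_cst.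
apply: cvgV; first by rewrite gt_eqF// Poisson_den_gt0.
apply: cvgD; first exact: cvg_cst.
apply: (@continuous_comp _ _ _ (fun z : R => 2 * pi * z) (fun w => w ^+ 2)).
  by apply: cvgM; [exact: cvg_cst|exact: cvg_id].
exact: exprn_continuous.
Qed.

Lemma measurable_Poisson_product n (e : R) : 0 < e ->
  measurable_fun setT (@Poisson_product n e).
Proof.
move=> e0; apply: measurable_prodr => i.
apply: (measurableT_comp (measurable_Poisson_factor e0)).
apply: measurable_funB.
  by apply: (measurableT_comp (measurable_tnth i)); exact: measurable_fst.
by apply: (measurableT_comp (measurable_tnth i)); exact: measurable_snd.
Qed.

Lemma integral_Poisson_product_le n (e : R) (x : n.-tuple R) : 0 < e ->
  (\int[Rn_measure R n]_y (Poisson_product e (x, y))%:E <= 1%:E)%E.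
Proof.
move=> e0; rewrite -Rn_integralE//; last 2 first.
- apply/measurable_EFinP; apply: (measurableT_comp (@measurable_Poisson_product n e e0)).
  exact: measurable_fun_pair.
- by move=> y; rewrite lee_fin Poisson_product_ge0.
rewrite (Rn_integral_prod
  (phi := fun i y => 2 * e / (e ^+ 2 + (2 * pi * (tnth x i - y)) ^+ 2))); last 2 first.
- move=> i; apply: (measurableT_comp (measurable_Poisson_factor e0)).
  by apply: measurable_funB => //; exact: measurable_cst.
- by move=> i y; rewrite divr_ge0 ?mulr_ge0 ?(ltW (Poisson_den_gt0 _ _)) ?(ltW e0).
(* Nonnegativity is added because products of extended reals are monotone only on nonnegative
   factors. *)
suff /andP[] : (0 <= \prod_(i < n) \int[leb]_y
    (2 * e / (e ^+ 2 + (2 * pi * (tnth x i - y)) ^+ 2))%:E <= 1)%E by [].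
apply: (big_ind (fun u : \bar R => 0 <= u <= 1)%E).
- by rewrite lee01 lexx.
- move=> u v /andP[u0 u1] /andP[v0 v1]; rewrite mule_ge0//=.
  by rewrite -[leRHS]mule1; exact: lee_pmul.
- move=> i _; rewrite integral_poisson_le// integral_ge0// => y _.
  by rewrite lee_fin divr_ge0 ?mulr_ge0 ?(ltW (Poisson_den_gt0 _ _)) ?(ltW e0).
Qed.

Definition phase_cos n (z : n.-tuple R * n.-tuple R) : R := cos (2 * pi * dotRn z.1 z.2).
Definition phase_sin n (z : n.-tuple R * n.-tuple R) : R := sin (2 * pi * dotRn z.1 z.2).

Lemma measurable_phase_cos n : measurable_fun setT (@phase_cos n).
Proof. by apply: measurable_phase; exact: continuous_cos. Qed.

Lemma measurable_phase_sin n : measurable_fun setT (@phase_sin n).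
Proof. by apply: measurable_phase; exact: continuous_sin. Qed.

Lemma phase_cos_le1 n (z : n.-tuple R * n.-tuple R) : `|phase_cos z| <= 1.
Proof. by rewrite ler_norml cos_geN1 cos_le1. Qed.

Lemma phase_sin_le1 n (z : n.-tuple R * n.-tuple R) : `|phase_sin z| <= 1.
Proof. by rewrite ler_norml sin_geN1 sin_le1. Qed.

(** The subtraction formula merges the two products into one cosine whose phase is linear in xi. *)
Lemma integral_Abel_weight_phase n (e : R) (x y : n.-tuple R) : 0 < e ->
  (\int[Rn_measure R n]_xi (Abel_weight e xi * (phase_cos (x, xi) * phase_cos (y, xi) +
     phase_sin (x, xi) * phase_sin (y, xi)))%:E = (Poisson_product e (x, y))%:E)%E.
Proof.
move=> e0.
have E xi : Abel_weight e xi * (phase_cos (x, xi) * phase_cos (y, xi) +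
     phase_sin (x, xi) * phase_sin (y, xi)) =
   1 * (\prod_(i < n) expR (- (e * `|tnth xi i|)) *
     cos (0 + \sum_(i < n) (2 * pi * (tnth x i - tnth y i)) * tnth xi i)).
  rewrite mul1r -cosB add0r /=; congr (_ * cos _).
  rewrite /dotRn !mulr_sumr -sumrB; apply: eq_bigr => i _; ring.
under eq_integral do rewrite E.
rewrite -integrable_Rn_integralE; last first.
  apply: (le_integrable _ _ _ (integrable_Abel_weight n e0)) => //.
    apply/measurable_EFinP; apply: measurable_funM; first exact: measurable_cst.
    apply: measurable_funM; first exact: measurable_Abel_weight.
    apply: measurableT_comp; first exact: continuous_measurable_fun (@continuous_cos R).
    apply: measurable_funD; first exact: measurable_cst.
    apply: measurable_sum => i; apply: measurable_funM; first exact: measurable_cst.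
    exact: measurable_tnth.
  move=> xi _ /=; rewrite lee_fin mul1r normrM -[leRHS]mulr1 ler_wpM2l//.
  by rewrite ler_norml cos_geN1 cos_le1.
by rewrite Rn_integral_expRN_cos// cos0 !mul1r.
Qed.

Lemma Abel_bessel n (e : R) (f : n.-tuple R -> R) : 0 < e ->
  (Rn_measure R n).-integrable setT (EFin \o f) ->
  (\int[Rn_measure R n]_xi (Abel_weight e xi *
     (modulated_integral (Rn_measure R n) f (@phase_cos n) xi ^+ 2 +
      modulated_integral (Rn_measure R n) f (@phase_sin n) xi ^+ 2))%:E <=
   \int[Rn_measure R n]_x (f x ^+ 2)%:E)%E.
Proof.
move=> e0 intf; rewrite -[leRHS]mul1e.
apply: (positive_kernel_bessel (k := @Poisson_product n e)) => //.
- exact: measurable_phase_cos.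
- exact: measurable_phase_sin.
- exact: phase_cos_le1.
- exact: phase_sin_le1.
- exact: integrable_Abel_weight.
- exact: measurable_Poisson_product.
- by move=> z; exact: Poisson_product_ge0.
- move=> x y; apply: eq_bigr => i _ /=; rewrite -(opprB (tnth y i)) mulrN sqrrN//.
- by move=> x y; exact: integral_Abel_weight_phase.
- by move=> x; exact: integral_Poisson_product_le.
Qed.

(** Along e = 1 / (j + 1) the Abel weight increases to 1, and the bound of [Abel_bessel] is
    independent of e, so monotone convergence removes the weight. *)
Lemma bessel_Rn n (f : n.-tuple R -> R) :
  (Rn_measure R n).-integrable setT (EFin \o f) ->
  (\int[Rn_measure R n]_xi
     (modulated_integral (Rn_measure R n) f (@phase_cos n) xi ^+ 2 +
      modulated_integral (Rn_measure R n) f (@phase_sin n) xi ^+ 2)%:E <=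
   \int[Rn_measure R n]_x (f x ^+ 2)%:E)%E.
Proof.
move=> intf.
have mf : measurable_fun setT f by case/integrableP : (intf) => /measurable_EFinP.
set C := modulated_integral _ f (@phase_cos n).
set S := modulated_integral _ f (@phase_sin n).
have mC : measurable_fun setT C by apply: measurable_modulated_integral => //; exact: measurable_phase_cos.
have mS : measurable_fun setT S by apply: measurable_modulated_integral => //; exact: measurable_phase_sin.
pose g (j : nat) xi := (Abel_weight (harmonic j) xi * (C xi ^+ 2 + S xi ^+ 2))%:E.
have h0 xi : 0 <= C xi ^+ 2 + S xi ^+ 2 by rewrite addr_ge0// sqr_ge0.
have s0 (xi : n.-tuple R) : 0 <= \sum_(i < n) `|tnth xi i| by apply: sumr_ge0.
have glim xi : g ^~ xi @ \oo --> (C xi ^+ 2 + S xi ^+ 2)%:E.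
  rewrite -[X in _ --> X%:E]mul1r; apply: cvg_EFin; first exact: nearW.
  apply: cvgM; last exact: cvg_cst.
  have -> : (1 : R) = expR (- (0 * \sum_(i < n) `|tnth xi i|)) by rewrite mul0r oppr0 expR0.
  under eq_fun do rewrite Abel_weightE.
  apply: continuous_cvg; first exact: continuous_expR.
  by apply: cvgN; apply: cvgM; [exact: cvg_harmonic|exact: cvg_cst].
have mg j : measurable_fun setT (g j).
  apply/measurable_EFinP; apply: measurable_funM; first exact: measurable_Abel_weight.
  by apply: measurable_funD; exact: measurable_funX.
have g0 j xi : setT xi -> (0 <= g j xi)%E.
  by move=> _; rewrite lee_fin mulr_ge0// Abel_weight_ge0.
have ndg xi : setT xi -> nondecreasing_seq (g ^~ xi).
  move=> _ i j ij; rewrite lee_fin ler_wpM2r// !Abel_weightE ler_expR lerN2.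
  by rewrite ler_wpM2r// lef_pV2 ?posrE ?ltr0n// ler_nat ltnS.
have := @cvg_monotone_convergence _ _ R (Rn_measure R n) setT measurableT g mg g0 ndg.
rewrite (_ : (fun x => limn (g^~ x)) = (fun xi => (C xi ^+ 2 + S xi ^+ 2)%:E)); last first.
  by apply/funext => xi; apply/cvg_lim => //; exact: glim.
move=> H; rewrite -(cvg_lim _ H)//; apply: lime_le; first by apply/cvg_ex; eexists; exact: H.
by apply: nearW => j; apply: Abel_bessel => //; exact: harmonic_gt0.
Qed.

End bessel_Rn.

(** * The L^2 bound for the Fourier transform *)

Section plancherel.
Context (R : realType) (n : nat).
Notation mu := (Rn_measure R n).

Lemma ler_norm_euclid (x : n.-tuple R) (i : 'I_n) : `|tnth x i| <= euclid x.
Proof.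
rewrite -sqrtr_sqr ler_sqrt; last by apply: sumr_ge0 => j _; exact: sqr_ge0.
by rewrite (bigD1 i)//= lerDl; apply: sumr_ge0 => j _; exact: sqr_ge0.
Qed.

Lemma measurable_euclid : measurable_fun setT (@euclid R n).
Proof.
apply: (@measurableT_comp _ _ _ _ _ _ (@Num.sqrt R)).
  by apply: continuous_measurable_fun; exact: sqrt_continuous.
by apply: measurable_sum => i; apply: measurable_funX; exact: measurable_tnth.
Qed.

Definition ball_truncation (r : R) (f : n.-tuple R -> R) (x : n.-tuple R) : R :=
  if euclid x <= r then f x else 0.

Lemma measurable_ball_truncation (r : R) (f : n.-tuple R -> R) :
  measurable_fun setT f -> measurable_fun setT (ball_truncation r f).
Proof.
move=> mf; apply: measurable_fun_ifT => //.
by apply: measurable_fun_ler; [exact: measurable_euclid|exact: measurable_cst].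
Qed.

(** Square integrable functions are integrable on balls. The volume of a ball is not computed: on
    the ball |f| is at most 1 + f^2, and 1 is at most a multiple of an Abel weight, already known to
    be integrable. *)
Lemma integrable_ball_truncation (r : R) (f : n.-tuple R -> R) :
  measurable_fun setT f -> mu.-integrable setT (EFin \o (fun x => f x ^+ 2)) ->
  mu.-integrable setT (EFin \o ball_truncation r f).
Proof.
move=> mf if2.
have iA := integrableZl measurableT (expR (n%:R * `|r|)) (integrable_Abel_weight n (@ltr01 R)).
apply: (le_integrable _ _ _ (integrableD measurableT iA if2)) => //.
  by apply/measurable_EFinP; exact: measurable_ball_truncation.
move=> x _ /=; rewrite lee_fin.
have eA0 : 0 <= expR (n%:R * `|r|) * Abel_weight 1 x.
  by apply: mulr_ge0; [exact: expR_ge0|exact: Abel_weight_ge0].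
rewrite [leRHS]ger0_norm; last by rewrite addr_ge0// sqr_ge0.
rewrite /ball_truncation; case: ifPn => xr; last by rewrite normr0 addr_ge0// sqr_ge0.
(* Each of the n coordinates has modulus at most r on the ball, so their sum is at most n |r|. *)
have A1 : 1 <= expR (n%:R * `|r|) * Abel_weight 1 x.
  rewrite Abel_weightE -expRD -[leLHS]expR0 ler_expR mul1r subr_ge0.
  rewrite mulr_natl -[n in leRHS]card_ord -sumr_const; apply: ler_sum => i _.
  by rewrite (le_trans (ler_norm_euclid x i))// (le_trans xr)// ler_norm.
apply: (@le_trans _ _ (1 + f x ^+ 2)); last by rewrite lerD2r.
rewrite -(real_normK (num_real (f x))) -subr_ge0.
rewrite (_ : _ - _ = (`|f x| - 2^-1) ^+ 2 + 3 / 4); last by field.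
by rewrite addr_ge0// sqr_ge0.
Qed.

Section truncated_transform.
Variables (f1 f2 : n.-tuple R -> R).
Hypotheses (mf1 : measurable_fun setT f1) (mf2 : measurable_fun setT f2).
Hypotheses (if1 : mu.-integrable setT (EFin \o (fun x => f1 x ^+ 2)))
  (if2 : mu.-integrable setT (EFin \o (fun x => f2 x ^+ 2))).
Variable r : R.

Let C i := modulated_integral mu (ball_truncation r i) (@phase_cos R n).
Let S i := modulated_integral mu (ball_truncation r i) (@phase_sin R n).

Let icos f xi (mf : measurable_fun setT f) if_ :=
  integrable_modulated (integrable_ball_truncation r mf if_) xi
    (@measurable_phase_cos R n) (@phase_cos_le1 R n).
Let isin f xi (mf : measurable_fun setT f) if_ :=
  integrable_modulated (integrable_ball_truncation r mf if_) xi
    (@measurable_phase_sin R n) (@phase_sin_le1 R n).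

Lemma trunc_FT_reE xi : trunc_FT_re f1 f2 r xi = C f1 xi + S f2 xi.
Proof.
have ic := icos xi mf1 if1; have is_ := isin xi mf2 if2.
rewrite /C /S /modulated_integral -RintegralD//.
rewrite /trunc_FT_re /Rintegral; congr fine.
rewrite (_ : (fun x => _) = EFin \o (fun x => ball_truncation r f1 x * phase_cos (x, xi) +
    ball_truncation r f2 x * phase_sin (x, xi))); last first.
  by apply/funext => x /=; rewrite /ball_truncation; case: ifP; rewrite // !mul0r addr0.
rewrite integrable_Rn_integralE//.
exact: (integrableD measurableT ic is_).
Qed.

Lemma trunc_FT_imE xi : trunc_FT_im f1 f2 r xi = C f2 xi - S f1 xi.
Proof.
have ic := icos xi mf2 if2; have is_ := isin xi mf1 if1.
rewrite /C /S /modulated_integral -RintegralB//.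
rewrite /trunc_FT_im /Rintegral; congr fine.
rewrite (_ : (fun x => _) = EFin \o (fun x => ball_truncation r f2 x * phase_cos (x, xi) -
    ball_truncation r f1 x * phase_sin (x, xi))); last first.
  by apply/funext => x /=; rewrite /ball_truncation; case: ifP; rewrite // !mul0r subr0.
rewrite integrable_Rn_integralE//.
exact: (integrableB measurableT ic is_).
Qed.

(** The Bessel inequality is for real functions; the factor 2 is the cost of bounding the squares of
    C f1 + S f2 and C f2 - S f1 by those of their terms. *)
Lemma trunc_FT_bessel :
  measurable_fun setT (trunc_FT_re f1 f2 r) /\ measurable_fun setT (trunc_FT_im f1 f2 r) /\
  (\int[mu]_xi (trunc_FT_re f1 f2 r xi ^+ 2 + trunc_FT_im f1 f2 r xi ^+ 2)%:E <=
   2%:E * (\int[mu]_x (f1 x ^+ 2)%:E + \int[mu]_x (f2 x ^+ 2)%:E))%E.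
Proof.
have mC (f : n.-tuple R -> R) : measurable_fun setT f -> mu.-integrable setT (EFin \o (fun x => f x ^+ 2)) ->
    measurable_fun setT (C f).
  move=> mf if_; apply: (measurable_modulated_integral (integrable_ball_truncation r mf if_)).
  exact: measurable_phase_cos.
have mS (f : n.-tuple R -> R) : measurable_fun setT f -> mu.-integrable setT (EFin \o (fun x => f x ^+ 2)) ->
    measurable_fun setT (S f).
  move=> mf if_; apply: (measurable_modulated_integral (integrable_ball_truncation r mf if_)).
  exact: measurable_phase_sin.
have -> : trunc_FT_re f1 f2 r = C f1 \+ S f2 by apply/funext => xi; exact: trunc_FT_reE.
have -> : trunc_FT_im f1 f2 r = C f2 \- S f1 by apply/funext => xi; exact: trunc_FT_imE.
split; first by apply: measurable_funD; [exact: mC|exact: mS].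
split; first by apply: measurable_funB; [exact: mC|exact: mS].
have mCS2 (f : n.-tuple R -> R) : measurable_fun setT f -> mu.-integrable setT (EFin \o (fun x => f x ^+ 2)) ->
    measurable_fun setT (fun xi => (C f xi ^+ 2 + S f xi ^+ 2)%:E).
  move=> mf if_; apply/measurable_EFinP.
  by apply: measurable_funD; apply: measurable_funX; [exact: mC|exact: mS].
have CS0 (f : n.-tuple R -> R) xi : (0 <= (C f xi ^+ 2 + S f xi ^+ 2)%:E)%E.
  by rewrite lee_fin addr_ge0// sqr_ge0.
apply: (@le_trans _ _ (\int[mu]_xi (2%:E * ((C f1 xi ^+ 2 + S f1 xi ^+ 2)%:E +
    (C f2 xi ^+ 2 + S f2 xi ^+ 2)%:E)))%E).
  apply: nonneg_le_integral => xi _.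
    by rewrite lee_fin addr_ge0// sqr_ge0.
  rewrite -EFinD -EFinM lee_fin /= -subr_ge0.
  move: (C f1 xi) (S f1 xi) (C f2 xi) (S f2 xi) => a b c d.
  rewrite [X in 0 <= X](_ : _ = (a - d) ^+ 2 + (b + c) ^+ 2); last by ring.
  by rewrite addr_ge0// sqr_ge0.
rewrite ge0_integralZl//; last 2 first.
- by apply: emeasurable_funD; exact: mCS2.
- by move=> xi _; exact: adde_ge0.
rewrite ge0_integralD//; [|exact: mCS2|exact: mCS2].
apply: lee_wpmul2l => //.
have bf (f : n.-tuple R -> R) : measurable_fun setT f -> mu.-integrable setT (EFin \o (fun x => f x ^+ 2)) ->
    (\int[mu]_xi (C f xi ^+ 2 + S f xi ^+ 2)%:E <= \int[mu]_x (f x ^+ 2)%:E)%E.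
  move=> mf if_; apply: (le_trans (bessel_Rn (integrable_ball_truncation r mf if_))).
  apply: nonneg_le_integral => x _; rewrite lee_fin ?sqr_ge0// /ball_truncation.
  by case: ifP => // _; rewrite expr0n sqr_ge0.
by apply: leeD; exact: bf.
Qed.

End truncated_transform.

(** The constant 4 is 2 from [trunc_FT_bessel] times 2 from comparing G with a truncated
    transform. *)
Lemma L2norm_sq_FT_le (f1 f2 G1 G2 : n.-tuple R -> R) :
  L2fun f1 f2 -> is_L2_FT f1 f2 G1 G2 ->
  (L2norm_sq G1 G2 <= 4%:E * L2norm_sq f1 f2)%E.
Proof.
move=> [mf1 [mf2 ff]] [mG1 [mG2 D0]].
have mE (g1 g2 : n.-tuple R -> R) : measurable_fun setT g1 -> measurable_fun setT g2 ->
    measurable_fun setT (fun x => (g1 x ^+ 2 + g2 x ^+ 2)%:E).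
  move=> m1 m2; apply/measurable_EFinP.
  by apply: measurable_funD; exact: measurable_funX.
have ge0 (g1 g2 : n.-tuple R -> R) x : (0 <= (g1 x ^+ 2 + g2 x ^+ 2)%:E)%E.
  by rewrite lee_fin addr_ge0// sqr_ge0.
have LE (g1 g2 : n.-tuple R -> R) : measurable_fun setT g1 -> measurable_fun setT g2 ->
    Rn_integral (fun x => (g1 x ^+ 2 + g2 x ^+ 2)%:E) =
    (\int[mu]_x (g1 x ^+ 2)%:E + \int[mu]_x (g2 x ^+ 2)%:E)%E.
  move=> m1 m2; rewrite Rn_integralE//; last exact: mE.
  under eq_integral do rewrite EFinD.
  rewrite ge0_integralD// => [x _||x _|]; try by rewrite lee_fin sqr_ge0.
    by apply/measurable_EFinP; exact: measurable_funX.
  by apply/measurable_EFinP; exact: measurable_funX.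
have ff' := ff; rewrite LE// in ff'.
have sq0 (g : n.-tuple R -> R) : (0 <= \int[mu]_x (g x ^+ 2)%:E)%E.
  by apply: integral_ge0 => x _; rewrite lee_fin sqr_ge0.
have sqint (g : n.-tuple R -> R) : measurable_fun setT g -> (\int[mu]_x (g x ^+ 2)%:E < +oo)%E ->
    mu.-integrable setT (EFin \o (fun x => g x ^+ 2)).
  move=> mg gfin; apply/integrableP; split.
    by apply/measurable_EFinP; exact: measurable_funX.
  by under eq_integral do rewrite /= ger0_norm ?sqr_ge0//.
have if1 : mu.-integrable setT (EFin \o (fun x => f1 x ^+ 2)).
  by apply: sqint => //; apply: le_lt_trans ff'; exact: leeDl.
have if2 : mu.-integrable setT (EFin \o (fun x => f2 x ^+ 2)).
  by apply: sqint => //; apply: le_lt_trans ff'; exact: leeDr.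
rewrite /L2norm_sq [in leRHS]LE//.
set N := (_ + _)%E.
set D := (fun r : R => _) in D0.
have Nfin : N \is a fin_num by rewrite ge0_fin_numE// adde_ge0.
(* Valid for every radius, even where D r is infinite; only the limit in r makes the first term
   vanish. *)
have key r : (Rn_integral (fun x => (G1 x ^+ 2 + G2 x ^+ 2)%:E) <= 2%:E * D r + 4%:E * N)%E.
  have [mT1 [mT2 TN]] := trunc_FT_bessel mf1 mf2 if1 if2 r.
  pose H1 xi := trunc_FT_re f1 f2 r xi - G1 xi.
  pose H2 xi := trunc_FT_im f1 f2 r xi - G2 xi.
  rewrite /D !Rn_integralE//; last 3 first.
  - by apply: (mE H1 H2); exact: measurable_funB.
  - by move=> x; exact: (ge0 H1 H2).
  - exact: mE.
  apply: (@le_trans _ _ (\int[mu]_x (2%:E * ((trunc_FT_re f1 f2 r x - G1 x) ^+ 2 +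
      (trunc_FT_im f1 f2 r x - G2 x) ^+ 2)%:E +
      2%:E * (trunc_FT_re f1 f2 r x ^+ 2 + trunc_FT_im f1 f2 r x ^+ 2)%:E))%E).
    apply: nonneg_le_integral => x _; first exact: ge0.
    rewrite -!EFinM -EFinD lee_fin; set a := trunc_FT_re _ _ _ _; set b := trunc_FT_im _ _ _ _.
    rewrite -subr_ge0 (_ : _ - _ = (2 * a - G1 x) ^+ 2 + (2 * b - G2 x) ^+ 2); last by ring.
    by rewrite addr_ge0// sqr_ge0.
  have mT := mE _ _ mT1 mT2.
  have mH : measurable_fun setT (fun x => ((trunc_FT_re f1 f2 r x - G1 x) ^+ 2 +
      (trunc_FT_im f1 f2 r x - G2 x) ^+ 2)%:E).
    by apply: (mE H1 H2); exact: measurable_funB.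
  rewrite ge0_integralD//; last 4 first.
  - by move=> x _; rewrite -EFinM lee_fin mulr_ge0// addr_ge0// sqr_ge0.
  - by apply: emeasurable_funM => //; exact: measurable_cst.
  - by move=> x _; rewrite -EFinM lee_fin mulr_ge0// addr_ge0// sqr_ge0.
  - by apply: emeasurable_funM => //; exact: measurable_cst.
  rewrite !ge0_integralZl//; last first.
    by move=> x _; exact: (ge0 H1 H2).
  apply: leeD => //; rewrite (_ : 4%:E = 2%:E * 2%:E)%E; last by rewrite -EFinM; congr EFin; ring.
  by rewrite -muleA lee_wpmul2l.
have lim : (2%:E * D r + 4%:E * N @[r --> +oo%R] --> 2%:E * 0 + 4%:E * N)%E.
  apply: cvgeD; [|exact: cvgeZl|exact: cvg_cst].
  by rewrite mule0 fin_num_adde_defr.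
rewrite mule0 add0e in lim; rewrite -(cvg_lim _ lim)//.
apply: lime_ge; first by apply/cvg_ex; eexists; exact: lim.
exact: nearW.
Qed.

End plancherel.

(** * The BMO norm *)

Section bmo.
Context (R : realType).
Notation leb := (@lebesgue_measure R).

Lemma abse_fine_le (x : \bar R) : (`|fine x|%:E <= `|x|)%E.
Proof. by case: x => [r||] /=; rewrite ?normr0 ?leey ?lexx. Qed.

(** [fine] sends infinite values to 0, so it never increases the modulus, and the bound holds even
    when the integral of f is meaningless. *)
Lemma fine_Rn_integral_le n (f : n.-tuple R -> \bar R) (g : n.-tuple R -> \bar R) (m : R) :
  (forall x, `|f x| <= g x)%E -> (Rn_integral g <= m%:E)%E ->
  `|fine (Rn_integral f)| <= 2 ^+ n * m.
Proof.
move=> fg gm; rewrite -lee_fin; apply: (le_trans (abse_fine_le _)).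
apply: (le_trans (abse_Rn_integral_le _)); rewrite EFinM.
apply: lee_wpmul2l; first by rewrite lee_fin exprn_ge0.
by apply: le_trans gm; apply: nonneg_le_Rn_integral.
Qed.

(** In product form the indicator is within reach of [Rn_integral_prod]. *)
Lemma indic_cubeE n (a x : n.-tuple R) (l : R) :
  \1_(cube a l) x = \prod_(i < n) (\1_(`[tnth a i, tnth a i + l]%classic) (tnth x i) : R).
Proof.
rewrite indicE; have [/set_mem xQ|xQ] := boolP (x \in cube a l).
  rewrite big1// => i _; rewrite indicE mem_set//=.
  by rewrite in_itv/=; exact: xQ.
have /existsP[i xi] : [exists i, ~~ (tnth a i <= tnth x i <= tnth a i + l)].
  rewrite -negb_forall; apply: contra xQ => /forallP xQ; apply/mem_set => i; exact: xQ.
rewrite (bigD1 i)//= indicE memNset ?mul0r//=.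
by rewrite in_itv/=; exact/negP.
Qed.

Lemma measurable_indic_cube n (a : n.-tuple R) (l : R) :
  measurable_fun setT (\1_(cube a l) : n.-tuple R -> R).
Proof.
rewrite (_ : \1_(cube a l) =
  (fun x => \prod_(i < n) (\1_(`[tnth a i, tnth a i + l]%classic) (tnth x i) : R))); last first.
  by apply/funext => x; exact: indic_cubeE.
apply: measurable_prodr => i; apply: measurableT_comp; last exact: measurable_tnth.
exact: measurable_indic.
Qed.

Lemma Rn_integral_cube n (a : n.-tuple R) (l b : R) : 0 < l -> 0 <= b ->
  Rn_integral (fun x => (\1_(cube a l) x * b)%:E) = (b * l ^+ n)%:E.
Proof.
move=> l0 b0.
under eq_fun do rewrite mulrC EFinM.
rewrite Rn_integralZl//; last first.
  by apply/measurable_EFinP; exact: measurable_indic_cube.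
rewrite EFinM; congr (_ * _)%E.
under eq_fun do rewrite indic_cubeE.
rewrite (Rn_integral_prod (phi := fun i => \1_(`[tnth a i, tnth a i + l]%classic))); last 2 first.
- by move=> i; exact: measurable_indic.
- by move=> i x; rewrite indicE ler0n.
have E i : (\int[leb]_x (\1_(`[tnth a i, tnth a i + l]%classic) x)%:E = l%:E)%E.
  rewrite integral_indic//= setIT lebesgue_measure_itv/= lte_fin ltrDl l0.
  by rewrite -EFinB addrAC subrr add0r.
under eq_bigr do rewrite E.
by rewrite prodEFin prodr_const card_ord.
Qed.

Lemma cube_avg_le n (a : n.-tuple R) (l b : R) (g : n.-tuple R -> R) : 0 < l ->
  (forall x, `|g x| <= b) -> `|cube_avg a l g| <= 2 ^+ n * b.
Proof.
move=> l0 gb.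
have b0 : 0 <= b by apply: le_trans (gb a).
rewrite /cube_avg normrM normfV (ger0_norm (exprn_ge0 _ (ltW l0))) ler_pdivrMr ?exprn_gt0//.
rewrite -mulrA; apply: (fine_Rn_integral_le (g := fun x => (\1_(cube a l) x * b)%:E)).
  move=> x /=; rewrite lee_fin normrM; apply: ler_pM => //.
  by rewrite ger0_norm// indicE ler0n.
by rewrite Rn_integral_cube.
Qed.

(** An average exceeds b by a factor of at most 2^n, the price of not knowing g measurable. Hence a
    deviation is at most 2 * 2^n * b, its square 4 * 4^n * b^2, and the two components add up to
    8. *)
Lemma BMO_norm_sq_le n (g1 g2 : n.-tuple R -> R) (b : R) :
  (forall x, `|g1 x| <= b) -> (forall x, `|g2 x| <= b) ->
  (BMO_norm_sq g1 g2 <= (8 * 4 ^+ n * b ^+ 2)%:E)%E.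
Proof.
move=> g1b g2b; apply: ge_ereal_sup => _ [l /= l0 [a _ <-]].
have b0 : 0 <= b by apply: le_trans (g1b a).
have ln0 : 0 < l ^+ n by rewrite exprn_gt0.
have osc (g : n.-tuple R -> R) x : (forall x, `|g x| <= b) ->
    (g x - cube_avg a l g) ^+ 2 <= 4 * 4 ^+ n * b ^+ 2.
  move=> gb; rewrite -(real_normK (num_real _)).
  rewrite (_ : 4 * 4 ^+ n * b ^+ 2 = (2 * 2 ^+ n * b) ^+ 2); last first.
    by rewrite !exprMn -exprM mulnC exprM; congr (_ * _ ^+ _ * _); ring.
  rewrite ler_sqr ?nnegrE ?mulr_ge0 ?exprn_ge0//.
  rewrite (le_trans (ler_normB _ _))//.
  rewrite [leRHS](_ : _ = 2 ^+ n * b + 2 ^+ n * b); last by ring.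
  rewrite lerD//.
    rewrite (le_trans (gb x))// -[leLHS]mul1r ler_wpM2r//.
    by rewrite exprn_ege1 ?ler1n.
  exact: cube_avg_le.
apply: (@le_trans _ _ (((l ^+ n)^-1)%:E * (8 * 4 ^+ n * b ^+ 2 * l ^+ n)%:E)%E).
  apply: lee_wpmul2l; first by rewrite lee_fin invr_ge0 ltW.
  rewrite -(Rn_integral_cube a l0); last by rewrite !mulr_ge0 ?exprn_ge0.
  apply: nonneg_le_Rn_integral => x; rewrite lee_fin.
    by rewrite mulr_ge0 ?addr_ge0 ?sqr_ge0.
  rewrite ler_wpM2l//.
  rewrite (_ : 8 * 4 ^+ n * b ^+ 2 = 4 * 4 ^+ n * b ^+ 2 + 4 * 4 ^+ n * b ^+ 2); last by ring.
  by rewrite lerD// osc.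
by rewrite -EFinM lee_fin mulrC mulfK// gt_eqF.
Qed.

Lemma BMO_norm_sq_ge0 n (g1 g2 : n.-tuple R -> R) : (0 <= BMO_norm_sq g1 g2)%E.
Proof.
pose v (l : R) (a : n.-tuple R) := (((l ^+ n)^-1)%:E *
  cube_integral a l (fun x => ((g1 x - cube_avg a l g1) ^+ 2 + (g2 x - cube_avg a l g2) ^+ 2)%R))%E.
apply: le_ereal_sup_tmp; exists (v 1 [tuple of nseq n 0]).
  by exists 1 => /=; [exact: ltr01|exists [tuple of nseq n 0]].
apply: mule_ge0; first by rewrite lee_fin invr_ge0 exprn_ge0.
apply: Rn_integral_ge0 => x; rewrite lee_fin mulr_ge0 ?addr_ge0 ?sqr_ge0//.
Qed.

Lemma frac_heat_re_le n (alpha t m : R) (G1 G2 : n.-tuple R -> R) x :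
  (Rn_integral (fun xi => (frac_heat_symbol alpha t xi * (`|G1 xi| + `|G2 xi|))%:E) <= m%:E)%E ->
  `|frac_heat_re alpha G1 G2 t x| <= 2 ^+ n * m.
Proof.
apply: fine_Rn_integral_le => xi /=; rewrite lee_fin normrM ger0_norm ?expR_ge0//.
rewrite ler_wpM2l ?expR_ge0// (le_trans (ler_normB _ _))// !normrM.
by rewrite lerD// -[leRHS]mulr1 ler_wpM2l// ler_norml ?cos_geN1 ?cos_le1 ?sin_geN1 ?sin_le1.
Qed.

Lemma frac_heat_im_le n (alpha t m : R) (G1 G2 : n.-tuple R -> R) x :
  (Rn_integral (fun xi => (frac_heat_symbol alpha t xi * (`|G1 xi| + `|G2 xi|))%:E) <= m%:E)%E ->
  `|frac_heat_im alpha G1 G2 t x| <= 2 ^+ n * m.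
Proof.
apply: fine_Rn_integral_le => xi /=; rewrite lee_fin normrM ger0_norm ?expR_ge0//.
rewrite ler_wpM2l ?expR_ge0// (le_trans (ler_normD _ _))// !normrM.
by rewrite lerD// -[leRHS]mulr1 ler_wpM2l// ler_norml ?cos_geN1 ?cos_le1 ?sin_geN1 ?sin_le1.
Qed.

(** With b = 2^n M the previous bound becomes 8 * 16^n * M^2. If M is infinite so is A, and nothing
    is left to prove. *)
Lemma BMO_frac_heat_le n (alpha t : R) (G1 G2 : n.-tuple R -> R) (A : \bar R) :
  let M := Rn_integral (fun xi => (frac_heat_symbol alpha t xi * (`|G1 xi| + `|G2 xi|))%:E) in
  (M * M <= A)%E ->
  (BMO_norm_sq (frac_heat_re alpha G1 G2 t) (frac_heat_im alpha G1 G2 t) <=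
   (8 * 16 ^+ n)%:E * A)%E.
Proof.
move=> M MA.
have M0 : (0 <= M)%E.
  by apply: Rn_integral_ge0 => xi; rewrite lee_fin mulr_ge0 ?expR_ge0// addr_ge0.
have c0 : 0 < 8 * 16 ^+ n :> R by rewrite mulr_gt0// exprn_gt0.
have [Mfin|] := boolP (M \is a fin_num); last first.
  rewrite ge0_fin_numE// -leNgt leye_eq => /eqP Moo.
  move: MA; rewrite Moo mulyy leye_eq => /eqP ->.
  by rewrite gt0_muley ?lte_fin// leey.
have Mle : (M <= (fine M)%:E)%E by rewrite fineK.
apply: (le_trans (BMO_norm_sq_le (fun x => frac_heat_re_le x Mle) (fun x => frac_heat_im_le x Mle))).
apply: (@le_trans _ _ ((8 * 16 ^+ n)%:E * (M * M))%E); last first.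
  by apply: lee_wpmul2l => //; rewrite lee_fin ltW.
rewrite -{2 3}(fineK Mfin) -!EFinM lee_fin.
rewrite exprMn -expr2 -exprM mulnC exprM !mulrA.
rewrite (_ : (16 : R) = 4 * 2 ^+ 2) ?exprMn ?mulrA//.
by ring.
Qed.

End bmo.

(** * The weighted estimate *)

Section weights.
Context (R : realType).
Notation leb := (@lebesgue_measure R).

Lemma measurable_sqrtV : measurable_fun setT (fun x : R => (Num.sqrt x)^-1).
Proof.
rewrite (_ : (fun x => _) = (@powR R ^~ (-1)) \o Num.sqrt); last first.
  by apply/funext => x /=; rewrite powR_inv1 ?sqrtr_ge0.
apply: measurableT_comp; first exact: measurable_powR.
by apply: continuous_measurable_fun; exact: sqrt_continuous.
Qed.

(** The share of one coordinate in the weighted symbol, with d as length scale. *)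
Definition radial_weight (d : R) (m : nat) (x : R) : R :=
  expR (- (`|x| / d) ^+ m) / Num.sqrt `|x|.

Lemma radial_weight_ge0 d m x : 0 <= radial_weight d m x.
Proof. by rewrite divr_ge0 ?expR_ge0 ?sqrtr_ge0. Qed.

Lemma measurable_radial_weight d m : measurable_fun setT (radial_weight d m).
Proof.
apply: measurable_funM.
  apply: measurableT_comp; first exact: measurable_expR.
  apply: measurable_funN; apply: measurable_funX.
  by apply: measurable_funM; [exact: normr_measurable|exact: measurable_cst].
by apply: (measurableT_comp measurable_sqrtV); exact: normr_measurable.
Qed.

Lemma integral_radial_weight_le (d : R) (m : nat) : (0 < m)%N -> 0 < d ->
  (\int[leb]_x (radial_weight d m x)%:E <= (16 * Num.sqrt d)%:E)%E.
Proof.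
move=> m0 d0.
have mg : measurable_fun setT (EFin \o radial_weight d m).
  by apply/measurable_EFinP; exact: measurable_radial_weight.
have g0 x : (0 <= (EFin \o radial_weight d m) x)%E by rewrite lee_fin radial_weight_ge0.
have half : (\int[leb]_(x in `[0%R, +oo[) (EFin \o radial_weight d m) x <= (8 * Num.sqrt d)%:E)%E.
  rewrite -integral_itv_obnd_cbnd; last exact: measurable_funTS.
  apply: le_trans (integral_expRN_sqrt_le m0 d0).
  apply: nonneg_le_integral => x /=; first by move=> _; exact: g0.
  by rewrite in_itv/= andbT /radial_weight => x0; rewrite gtr0_norm.
rewrite -[in leLHS](setUv `[0%R, +oo[%classic) ge0_integral_setU//=; last 4 first.
- exact: measurableC.
- by rewrite setUv.
- by move=> x _; exact: g0.
- by apply/disj_setPCl.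
rewrite setCitvr integral_itv_bndo_bndc; last exact: measurable_funTS.
have -> : (\int[leb]_(x in `]-oo, 0%R]) (radial_weight d m x)%:E =
    \int[leb]_(x in `[0%R, +oo[) (EFin \o radial_weight d m) x)%E.
  rewrite ge0_integration_by_substitution0//; apply: eq_integral => x _ /=.
  by rewrite /radial_weight normrN.
rewrite (_ : 16 = 8 + 8); last by ring.
by rewrite mulrDl EFinD; apply: leeD.
Qed.

Lemma Rn_integral_radial_weight_le n (d : R) (m : nat) : (0 < m)%N -> 0 < d ->
  (Rn_integral (fun xi : n.-tuple R => (\prod_(i < n) radial_weight d m (tnth xi i))%:E) <=
   ((16 * Num.sqrt d) ^+ n)%:E)%E.
Proof.
move=> m0 d0.
rewrite (Rn_integral_prod (phi := fun _ => radial_weight d m)); last 2 first.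
- by move=> i; exact: measurable_radial_weight.
- by move=> i; exact: radial_weight_ge0.
rewrite -[n in leRHS]card_ord -prodr_const.
suff /andP[] : (0 <= \prod_(i < n) \int[leb]_x (radial_weight d m x)%:E <=
  (\prod_(i in 'I_n) (16 * Num.sqrt d))%:E)%E by [].
apply: (big_ind2 (fun (u : \bar R) (v : R) => 0 <= u <= v%:E)%E).
- by rewrite lee01 lexx.
- move=> u u' v v' /andP[u0 u1] /andP[v0 v1]; rewrite mule_ge0//= EFinM.
  exact: lee_pmul.
- move=> i _; rewrite integral_radial_weight_le// integral_ge0// => x _.
  by rewrite lee_fin radial_weight_ge0.
Qed.

(** This is |xi|^(n/2), written as an n-th power so that each coordinate receives one factor. *)
Definition homogeneous_weight n (xi : n.-tuple R) : R := Num.sqrt (euclid xi) ^+ n.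

Lemma euclid_ge0 n (xi : n.-tuple R) : 0 <= euclid xi.
Proof. exact: sqrtr_ge0. Qed.

Lemma frac_heat_symbolE n (t : R) (xi : n.-tuple R) :
  frac_heat_symbol (n%:R / 2) t xi = expR (- (t * euclid xi ^+ n)).
Proof.
rewrite /frac_heat_symbol (_ : 2 * (n%:R / 2) = n%:R); last by field.
by rewrite powR_mulrn// euclid_ge0.
Qed.

(* The coordinates must be nonzero because [radial_weight] vanishes at 0 (x / 0 = 0). *)
Lemma symbol_weight_le n (t d : R) (xi : n.-tuple R) : (0 < n)%N -> 0 < t -> 0 < d ->
  d ^+ n = n%:R / t -> (forall i, tnth xi i != 0) ->
  expR (- (t * euclid xi ^+ n)) / homogeneous_weight xi <=
  \prod_(i < n) radial_weight d n (tnth xi i).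
Proof.
move=> n0 t0 d0 dE xi0.
have nR0 : 0 < n%:R :> R by rewrite ltr0n.
(* The radial function is split into n equal factors, and in the i-th one |xi| is lowered to |xi_i|.
   The choice of d turns t |xi_i|^n / n into (|xi_i| / d)^n. *)
have -> : expR (- (t * euclid xi ^+ n)) / homogeneous_weight xi =
    \prod_(i < n) (expR (- (t * euclid xi ^+ n / n%:R)) / Num.sqrt (euclid xi)).
  rewrite big_split/= -expR_sum !prodr_const sumr_const !card_ord /homogeneous_weight exprVn.
  by congr (expR _ / _); rewrite -[RHS]mulr_natr mulNr divfK ?gt_eqF.
apply: ler_prod => i _.
have xi_gt0 : 0 < `|tnth xi i| by rewrite normr_gt0.
have xiE := ler_norm_euclid xi i.
rewrite divr_ge0 ?expR_ge0 ?sqrtr_ge0//=.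
apply: ler_pM; rewrite ?expR_ge0 ?invr_ge0 ?sqrtr_ge0//.
  rewrite ler_expR lerN2 expr_div_n dE invf_div [leLHS]mulrA (mulrC _ t).
  by rewrite ler_wpM2r ?invr_ge0 ?(ltW nR0)// ler_wpM2l ?(ltW t0)// lerXn2r ?nnegrE ?euclid_ge0.
have E0 : 0 < euclid xi := lt_le_trans xi_gt0 xiE.
have sE0 : 0 < Num.sqrt (euclid xi) by rewrite sqrtr_gt0.
by rewrite lef_pV2 ?posrE ?(sqrtr_gt0 `|_|)// ler_wsqrtr.
Qed.

(** The indicator of a coordinate hyperplane is a product with one factor of integral 0; the other
    factors may have infinite integral, but 0 times infinity is 0. *)
Lemma ae_coordinates_neq0 n : {ae Rn_measure R n, forall xi, forall i, tnth xi i != 0}.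
Proof.
apply: filter_forall => i.
pose phi (j : 'I_n) : R -> R := if j == i then \1_[set 0] else cst 1.
have mphi j : measurable_fun setT (phi j).
  by rewrite /phi; case: ifP => _; [exact: measurable_indic|exact: measurable_cst].
have mZ : measurable [set xi : n.-tuple R | tnth xi i = 0].
  rewrite (_ : [set _ | _] = (fun xi => tnth xi i) @^-1` [set 0])//.
  by rewrite -[X in measurable X]setTI; apply: measurable_tnth.
exists [set xi | tnth xi i = 0]; split => //; last first.
  by move=> xi /= /negP; rewrite negbK => /eqP.
have -> : Rn_measure R n [set xi | tnth xi i = 0] =
    Rn_integral (fun xi => (\prod_(j < n) phi j (tnth xi j))%:E).
  transitivity (\int[Rn_measure R n]_xi (\1_[set xi : n.-tuple R | tnth xi i = 0] xi)%:E)%E.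
    by rewrite integral_indic// setIT.
  have mi : measurable_fun setT (\1_[set xi : n.-tuple R | tnth xi i = 0] : n.-tuple R -> R).
    exact: measurable_indic.
  rewrite -Rn_integralE//; last by have /measurable_EFinP := mi.
  congr Rn_integral; apply/funext => xi; congr EFin.
  rewrite (bigD1 i)//= big1 ?mulr1; last by move=> j /negbTE ji; rewrite /phi ji.
  by rewrite /phi eqxx !indicE; congr ((_ : bool)%:R); apply/idP/idP => /set_mem h; apply/mem_set.
rewrite Rn_integral_prod//; last first.
  by move=> j x; rewrite /phi; case: ifP => _ //; rewrite indicE ler0n.
rewrite (bigD1 i)//= /phi eqxx integral_indic//= setIT lebesgue_measure_set1.
by rewrite mul0e.
Qed.

(* Cauchy-Schwarz from the weighted AM-GM inequalities, optimal for l = B / M. *)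
Lemma mule_self_le (M A : \bar R) (B : R) : (0 <= M)%E -> (0 <= A)%E -> 0 < B ->
  (forall l : R, 0 < l -> (M <= (l / 2)%:E * A + (B / (2 * l))%:E)%E) ->
  (M * M <= B%:E * A)%E.
Proof.
move=> M0; case: A => [a a0 B0 H|_ B0 _|//]; last by rewrite gt0_muley ?lte_fin// leey.
case: M M0 H => [m m0 H|_ /(_ 1 ltr01)|//]; last by rewrite -EFinM -EFinD leye_eq.
rewrite lee_fin in m0; rewrite lee_fin in a0; rewrite -!EFinM.
have [m_gt0|] := ltP 0 m; last first.
  move=> mle; have -> : m = 0 by apply/le_anti; rewrite mle.
  by rewrite mul0r lee_fin mulr_ge0// ltW.
have := H (B / m) (divr_gt0 B0 m_gt0); rewrite -EFinM -EFinD lee_fin.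
rewrite (_ : B / (2 * (B / m)) = m / 2); last by field; rewrite !gt_eqF.
rewrite (_ : B / m / 2 * a = B * a / m / 2); last by ring.
move=> h; have : m <= B * a / m by lra.
by rewrite lee_fin ler_pdivlMr.
Qed.

End weights.

(** * The space-time estimate and the theorem *)

Section strichartz.
Context (R : realType) (n : nat).
Hypothesis n_gt0 : (0 < n)%N.
Notation leb := (@lebesgue_measure R).
Notation mu := (Rn_measure R n).

Lemma sqrtrX (x : R) k : 0 <= x -> Num.sqrt (x ^+ k) = Num.sqrt x ^+ k.
Proof.
move=> x0; elim: k => [|k IH]; first by rewrite !expr0 sqrtr1.
by rewrite !exprS sqrtrM// IH.
Qed.

Lemma measurable_homogeneous_weight : measurable_fun setT (@homogeneous_weight R n).
Proof.
apply: measurable_funX; apply: (measurableT_comp _ (@measurable_euclid R n)).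
by apply: continuous_measurable_fun; exact: sqrt_continuous.
Qed.

Lemma homogeneous_weight_ge0 (xi : n.-tuple R) : 0 <= homogeneous_weight xi.
Proof. by rewrite exprn_ge0// sqrtr_ge0. Qed.

Section amplitude.
Variable h : n.-tuple R -> R.
Hypotheses (mh : measurable_fun setT h) (h0 : forall xi, 0 <= h xi).

Definition weighted_energy (t : R) : \bar R :=
  Rn_integral (fun xi : n.-tuple R =>
    (expR (- (t * euclid xi ^+ n)) * (homogeneous_weight xi * h xi ^+ 2))%:E).

Lemma measurable_heat_symbol (t : R) :
  measurable_fun setT (fun xi : n.-tuple R => expR (- (t * euclid xi ^+ n))).
Proof.
apply: measurableT_comp; first exact: measurable_expR.
apply: measurable_funN; apply: measurable_funM; first exact: measurable_cst.
by apply: measurable_funX; exact: measurable_euclid.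
Qed.

Lemma weighted_energy_ge0 t : (0 <= weighted_energy t)%E.
Proof.
apply: Rn_integral_ge0 => xi; rewrite lee_fin mulr_ge0 ?expR_ge0//.
by rewrite mulr_ge0 ?homogeneous_weight_ge0 ?sqr_ge0.
Qed.

(** The constant is the bound (16 sqrt d)^n of [Rn_integral_radial_weight_le], where d^n = n / t. *)
Lemma Rn_integral_symbol_sq_le (t : R)
    (M := Rn_integral (fun xi : n.-tuple R => (frac_heat_symbol (n%:R / 2) t xi * h xi)%:E)) :
  0 < t ->
  (M * M <= (16 ^+ n * Num.sqrt (n%:R / t))%:E * weighted_energy t)%E.
Proof.
move=> t0.
have nR0 : 0 < n%:R :> R by rewrite ltr0n.
pose d := (n%:R / t) `^ (n%:R^-1).
have d0 : 0 < d by rewrite powR_gt0 ?divr_gt0.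
have dE : d ^+ n = n%:R / t.
  by rewrite -powR_mulrn ?(ltW d0)// -powRrM mulVf ?gt_eqF// powRr1// ltW ?divr_gt0.
have mS := measurable_heat_symbol t.
have mE : measurable_fun setT (fun xi : n.-tuple R =>
    (expR (- (t * euclid xi ^+ n)) * (homogeneous_weight xi * h xi ^+ 2))%:E).
  apply/measurable_EFinP; apply: measurable_funM => //; apply: measurable_funM.
    exact: measurable_homogeneous_weight.
  exact: measurable_funX.
have mP : measurable_fun setT (fun xi : n.-tuple R =>
    (\prod_(i < n) radial_weight d n (tnth xi i))%:E).
  apply/measurable_EFinP; apply: measurable_prodr => i.
  by apply: (measurableT_comp (measurable_radial_weight _ _)); exact: measurable_tnth.
have E0 xi : (0 <= (expR (- (t * euclid xi ^+ n)) * (homogeneous_weight xi * h xi ^+ 2))%:E)%E.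
  by rewrite lee_fin mulr_ge0 ?expR_ge0// mulr_ge0 ?homogeneous_weight_ge0 ?sqr_ge0.
have P0 (xi : n.-tuple R) : (0 <= (\prod_(i < n) radial_weight d n (tnth xi i))%:E)%E.
  by rewrite lee_fin prodr_ge0// => i _; exact: radial_weight_ge0.
have ME : M = (\int[mu]_xi (expR (- (t * euclid xi ^+ n)) * h xi)%:E)%E.
  rewrite /M -Rn_integralE.
  - by congr Rn_integral; apply/funext => xi; rewrite frac_heat_symbolE.
  - by apply/measurable_EFinP; exact: measurable_funM.
  - by move=> xi; rewrite lee_fin mulr_ge0 ?expR_ge0.
apply: mule_self_le.
- by apply: Rn_integral_ge0 => xi; rewrite lee_fin mulr_ge0 ?expR_ge0.
- exact: weighted_energy_ge0.
- by rewrite mulr_gt0 ?exprn_gt0 ?sqrtr_gt0 ?divr_gt0.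
move=> l l0.
have hl0 : 0 <= l / 2 by rewrite divr_ge0 ?ltW.
have il0 : 0 <= (2 * l)^-1 by rewrite invr_ge0 mulr_ge0 ?ltW.
apply: (@le_trans _ _ (\int[mu]_xi ((l / 2)%:E *
     (expR (- (t * euclid xi ^+ n)) * (homogeneous_weight xi * h xi ^+ 2))%:E +
   ((2 * l)^-1)%:E * (\prod_(i < n) radial_weight d n (tnth xi i))%:E))%E).
  rewrite ME; apply: ae_ge0_le_integral => //.
  - by move=> xi _; rewrite lee_fin mulr_ge0 ?expR_ge0.
  - by apply/measurable_EFinP; exact: measurable_funM.
  - by move=> xi _; apply: adde_ge0; apply: mule_ge0; rewrite // lee_fin.
  - by apply: emeasurable_funD; apply: emeasurable_funM => //; exact: measurable_cst.
  have := ae_coordinates_neq0 R n; apply: filterS => xi xi0 _.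
  have wle := symbol_weight_le n_gt0 t0 d0 dE xi0.
  rewrite -!EFinM -EFinD lee_fin.
  have w0 : 0 < homogeneous_weight xi.
    rewrite exprn_gt0// sqrtr_gt0.
    have i : 'I_n := Ordinal n_gt0.
    by apply: lt_le_trans (ler_norm_euclid xi i); rewrite normr_gt0.
  apply: (@le_trans _ _ (l / 2 *
      (expR (- (t * euclid xi ^+ n)) * (homogeneous_weight xi * h xi ^+ 2)) +
    (2 * l)^-1 * (expR (- (t * euclid xi ^+ n)) / homogeneous_weight xi))); last first.
    by rewrite lerD2l ler_wpM2l.
  move: (expR_ge0 (- (t * euclid xi ^+ n))) w0; 
  move: (expR _) (homogeneous_weight xi) (h xi) => s w y s0 w0.
  rewrite -subr_ge0.
  (* Pointwise weighted AM-GM for y = (l w y) / (l w), as a completed square. *)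
  rewrite [X in 0 <= X](_ : _ = s / (2 * l * w) * (l * w * y - 1) ^+ 2); last first.
    by field; rewrite !gt_eqF.
  by rewrite mulr_ge0 ?sqr_ge0// divr_ge0// !mulr_ge0 ?ltW.
rewrite ge0_integralD//; last 4 first.
- by move=> xi _; rewrite mule_ge0.
- by apply: emeasurable_funM => //; exact: measurable_cst.
- by move=> xi _; rewrite mule_ge0.
- by apply: emeasurable_funM => //; exact: measurable_cst.
rewrite !ge0_integralZl//.
apply: leeD; first by rewrite /weighted_energy Rn_integralE.
rewrite -Rn_integralE// (mulrC _ (2 * l)^-1) EFinM lee_wpmul2l//.
apply: (le_trans (Rn_integral_radial_weight_le n n_gt0 d0)).
by rewrite lee_fin exprMn -sqrtrX ?(ltW d0)// dE.
Qed.

Lemma integral_weighted_energy_le :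
  (\int[leb]_(t in `]0%R, +oo[) ((Num.sqrt t)^-1%:E * weighted_energy t) <=
   8%:E * Rn_integral (fun xi => (h xi ^+ 2)%:E))%E.
Proof.
(* Extending by 0 to t <= 0 replaces the time domain by the whole line, so that Tonelli applies to a
   jointly measurable function. *)
pose q (z : measurableTypeR R * n.-tuple R) : R :=
  if 0 < (z.1 : R) then (Num.sqrt z.1)^-1 * (expR (- (z.1 * euclid z.2 ^+ n)) *
    (homogeneous_weight z.2 * h z.2 ^+ 2)) else 0.
have mE t : measurable_fun setT (fun xi : n.-tuple R =>
    (expR (- (t * euclid xi ^+ n)) * (homogeneous_weight xi * h xi ^+ 2))%:E).
  apply/measurable_EFinP; apply: measurable_funM; first exact: measurable_heat_symbol.
  by apply: measurable_funM; [exact: measurable_homogeneous_weight|exact: measurable_funX].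
have E0 t xi : 0 <= expR (- (t * euclid xi ^+ n)) * (homogeneous_weight xi * h xi ^+ 2).
  by rewrite mulr_ge0 ?expR_ge0// mulr_ge0 ?homogeneous_weight_ge0 ?sqr_ge0.
have q0 z : (0 <= (q z)%:E)%E.
  by rewrite lee_fin /q; case: ifP => // _; rewrite mulr_ge0 ?invr_ge0 ?sqrtr_ge0.
have mfst : measurable_fun setT (fun z : measurableTypeR R * n.-tuple R => z.1 : R).
  exact: measurable_fst.
have msnd (g : n.-tuple R -> R) : measurable_fun setT g ->
    measurable_fun setT (fun z : measurableTypeR R * n.-tuple R => g z.2).
  by move=> mg; apply: (measurableT_comp mg); exact: measurable_snd.
have mq : measurable_fun setT (fun z => (q z)%:E).
  apply/measurable_EFinP; apply: measurable_fun_ifT.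
  - by apply: measurable_fun_ltr => //; exact: measurable_cst.
  - apply: measurable_funM; first exact: (measurableT_comp (@measurable_sqrtV R) mfst).
    apply: measurable_funM.
      apply: measurableT_comp; first exact: measurable_expR.
      apply: measurable_funN; apply: measurable_funM => //.
      by apply: measurable_funX; apply: (msnd _ (@measurable_euclid R n)).
    apply: measurable_funM; first exact: (msnd _ measurable_homogeneous_weight).
    by apply: measurable_funX; exact: (msnd _ mh).
  - exact: measurable_cst.
rewrite integral_mkcond.
apply: (@le_trans _ _ (\int[leb]_t \int[mu]_xi (q (t, xi))%:E)%E).
  apply: nonneg_le_integral => t _.
    rewrite patchE; case: ifPn => // _.
    by rewrite mule_ge0 ?weighted_energy_ge0// lee_fin invr_ge0 sqrtr_ge0.
  rewrite patchE; case: ifPn => [/set_mem /=|_]; last exact: integral_ge0.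
  rewrite in_itv/= andbT => t0.
  rewrite /weighted_energy Rn_integralE//; last by move=> xi; rewrite lee_fin.
  rewrite -ge0_integralZl//; last by move=> xi _; rewrite lee_fin.
  by under [leRHS]eq_integral do rewrite /q /= t0 EFinM.
rewrite (fubini_tonelli (fun z => (q z)%:E))// Rn_integralE//; last 2 first.
- by apply/measurable_EFinP; exact: measurable_funX.
- by move=> xi; rewrite lee_fin sqr_ge0.
rewrite -ge0_integralZl//; last 2 first.
- by apply/measurable_EFinP; exact: measurable_funX.
- by move=> xi _; rewrite lee_fin sqr_ge0.
apply: nonneg_le_integral => xi _; first exact: integral_ge0.
have := euclid_ge0 xi; rewrite le_eqVlt => /predU1P[Exi|Exi].
  (* At xi = 0 there is no decay in t, but the weight vanishes there because n > 0. *)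
  rewrite integral0_eq ?mule_ge0 ?lee_fin ?sqr_ge0// => t _.
  rewrite /q /= /homogeneous_weight -Exi sqrtr0 expr0n gtn_eqF// mul0r !mulr0.
  by case: ifP.
have En : 0 < euclid xi ^+ n by rewrite exprn_gt0.
have mD : measurable_fun (`]0, +oo[ : set R) (fun t : R =>
    (expR (- (t / (euclid xi ^+ n)^-1) ^+ 1) / Num.sqrt t)%:E).
  apply/measurable_funTS/measurable_EFinP; apply: measurable_funM; last exact: measurable_sqrtV.
  apply: measurableT_comp; first exact: measurable_expR.
  apply: measurable_funN; apply: measurable_funX.
  by apply: measurable_funM; [exact: measurable_id|exact: measurable_cst].
have c0 : 0 <= homogeneous_weight xi * h xi ^+ 2.
  by rewrite mulr_ge0 ?homogeneous_weight_ge0 ?sqr_ge0.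
have -> : (\int[leb]_t (q (t, xi))%:E = (homogeneous_weight xi * h xi ^+ 2)%:E *
   \int[leb]_(t in `]0%R, +oo[) (expR (- (t / (euclid xi ^+ n)^-1) ^+ 1) / Num.sqrt t)%:E)%E.
  rewrite -ge0_integralZl//.
  rewrite [RHS]integral_mkcond; apply: eq_integral => t _.
  rewrite patchE /q /=; case: ifPn => t0.
    rewrite mem_set /=; last by rewrite in_itv/= andbT.
    by rewrite -EFinM expr1 invrK; congr EFin; ring.
  by rewrite memNset//= in_itv/= andbT; exact/negP.
(* With m = 1 and d = |xi|^(-n) the time integral is at most 8 |xi|^(-n/2), which cancels the weight
   exactly. *)
apply: (@le_trans _ _ ((homogeneous_weight xi * h xi ^+ 2)%:E *
    (8 * Num.sqrt (euclid xi ^+ n)^-1)%:E)%E).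
  apply: lee_wpmul2l; first by rewrite lee_fin.
  by apply: integral_expRN_sqrt_le => //; rewrite invr_gt0.
rewrite -!EFinM lee_fin sqrtrV ?(ltW En)// sqrtrX ?(ltW Exi)// -/(homogeneous_weight xi).
have w0 : 0 < homogeneous_weight xi by rewrite exprn_gt0// sqrtr_gt0.
by rewrite (_ : _ * _ * _ = 8 * h xi ^+ 2)//; field; rewrite gt_eqF.
Qed.

End amplitude.

(** The constant collects 8 * 16^n from the BMO bound, 16^n sqrt n from Cauchy-Schwarz, 8 from the
    time integral, and 2 from (|G1| + |G2|)^2. *)
Lemma L2t_BMO_norm_sq_le (G1 G2 : n.-tuple R -> R) :
  measurable_fun setT G1 -> measurable_fun setT G2 ->
  (L2t_BMO_norm_sq (n%:R / 2) G1 G2 <=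
   (128 * 256 ^+ n * Num.sqrt n%:R)%:E * L2norm_sq G1 G2)%E.
Proof.
move=> mG1 mG2.
pose h xi := `|G1 xi| + `|G2 xi|.
have mh : measurable_fun setT h by apply: measurable_funD; exact: measurableT_comp.
have h0 xi : 0 <= h xi by rewrite addr_ge0.
have k0 : 0 <= 8 * 256 ^+ n * Num.sqrt n%:R :> R.
  by rewrite !mulr_ge0 ?exprn_ge0 ?sqrtr_ge0.
apply: (@le_trans _ _ (\int[leb]_(t in `]0%R, +oo[)
  ((8 * 256 ^+ n * Num.sqrt n%:R)%:E * ((Num.sqrt t)^-1%:E * weighted_energy h t)))%E).
  apply: nonneg_le_integral => t /=; rewrite in_itv/= andbT => t0.
    exact: BMO_norm_sq_ge0.
  apply: (le_trans (BMO_frac_heat_le (Rn_integral_symbol_sq_le mh h0 t0))).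
  rewrite !muleA -!EFinM sqrtrM ?ler0n// sqrtrV ?(ltW t0)//.
  rewrite (_ : (256 : R) = 16 * 16) ?exprMn; last by ring.
  by rewrite !mulrA.
have k1 : 0 < 8 * 256 ^+ n * Num.sqrt n%:R :> R.
  by rewrite !mulr_gt0 ?exprn_gt0 ?sqrtr_gt0 ?ltr0n.
apply: (le_trans (nonneg_integralZl_le _ _ k1)) => [t _|].
  by rewrite mule_ge0 ?weighted_energy_ge0// lee_fin invr_ge0 sqrtr_ge0.
have h2 : (Rn_integral (fun xi => (h xi ^+ 2)%:E) <= 2%:E * L2norm_sq G1 G2)%E.
  rewrite /L2norm_sq -Rn_integralZl//; last 2 first.
  - by apply/measurable_EFinP; apply: measurable_funD; exact: measurable_funX.
  - by move=> xi; rewrite lee_fin addr_ge0// sqr_ge0.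
  apply: nonneg_le_Rn_integral => xi; first by rewrite lee_fin sqr_ge0.
  rewrite -EFinM lee_fin /h -(real_normK (num_real (G1 xi))) -(real_normK (num_real (G2 xi))).
  rewrite -subr_ge0 [X in 0 <= X](_ : _ = (`|G1 xi| - `|G2 xi|) ^+ 2) ?sqr_ge0//.
  by ring.
apply: (@le_trans _ _ ((8 * 256 ^+ n * Num.sqrt n%:R)%:E * (8%:E * (2%:E * L2norm_sq G1 G2)))%E).
  apply: lee_wpmul2l; first by rewrite lee_fin.
  apply: (le_trans (integral_weighted_energy_le mh)).
  by apply: lee_wpmul2l.
rewrite !muleA -!EFinM (_ : _ * 8 * 2 = 128 * 256 ^+ n * Num.sqrt n%:R)//.
by ring.
Qed.

End strichartz.

(** R^0 is a single point, where nothing oscillates. The case is separate because the weighted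
    estimate divides by n. *)
Lemma BMO_norm_sq_dim0 (R : realType) (g1 g2 : 0.-tuple R -> R) :
  (BMO_norm_sq g1 g2 <= 0)%E.
Proof.
apply: ge_ereal_sup => _ [l /= l0 [a _ <-]].
have Q x : \1_(cube a l) x = 1 :> R by rewrite indic_cubeE big_ord0.
by rewrite /cube_integral /cube_avg /= !Q !mul1r !expr0 !divr1 !subrr expr0n addr0 mule0.
Qed.

(* f = f1 + i f2 in L^2(R^n), (G1, G2) its Fourier transform,
   alpha = n/2; the inequality is stated for squared norms:
   ||e^{-t(-Delta)^alpha} f||^2_{L^2_t BMO_x} <= C^2 ||f||^2_{L^2}. *)
Theorem theorem1p6 (R : realType) (n : nat) :
  let alpha : R := n%:R / 2 in
  exists C : R, 0 < C /\
    forall f1 f2 G1 G2 : n.-tuple R -> R,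
      L2fun f1 f2 -> is_L2_FT f1 f2 G1 G2 ->
      (L2t_BMO_norm_sq alpha G1 G2 <= (C ^+ 2)%:E * L2norm_sq f1 f2)%E.
Proof.
move=> alpha.
(* The factor 4 comes from [L2norm_sq_FT_le]; adding 1 keeps K positive when n = 0. Its root is the
   witness, since the claim is about squared norms. *)
pose K : R := 4 * (128 * 256 ^+ n * Num.sqrt n%:R) + 1.
have c0 : 0 <= 128 * 256 ^+ n * Num.sqrt n%:R :> R.
  by apply: mulr_ge0; [apply: mulr_ge0; rewrite // exprn_ge0|exact: sqrtr_ge0].
have K0 : 0 < K by rewrite ltr_wpDl// mulr_ge0.
exists (Num.sqrt K); split; first by rewrite sqrtr_gt0.
move=> f1 f2 G1 G2 f_L2 G_FT; rewrite sqr_sqrtr ?(ltW K0)//.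
have L0 (g1 g2 : n.-tuple R -> R) : (0 <= L2norm_sq g1 g2)%E.
  by apply: Rn_integral_ge0 => x; rewrite lee_fin addr_ge0// sqr_ge0.
have [n0|n_gt0] := posnP n.
  apply: (@le_trans _ _ 0%E); last by apply: mule_ge0 => //; rewrite lee_fin ltW.
  rewrite -(integral0 (@lebesgue_measure R) `]0%R, +oo[%classic).
  apply: nonneg_le_integral => t _; first exact: BMO_norm_sq_ge0.
  by subst n; exact: BMO_norm_sq_dim0.
have [_ [_ f_fin]] := f_L2; have [mG1 [mG2 _]] := G_FT.
apply: (le_trans (L2t_BMO_norm_sq_le n_gt0 mG1 mG2)).
apply: (@le_trans _ _ ((128 * 256 ^+ n * Num.sqrt n%:R)%:E * (4%:E * L2norm_sq f1 f2))%E).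
  apply: lee_wpmul2l; first by rewrite lee_fin.
  exact: L2norm_sq_FT_le.
rewrite muleA -EFinM; apply: lee_wpmul2r => //.
by rewrite lee_fin mulrC lerDl.
Qed.
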